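(* Let $p$ be a prime and let $S$ be a finite $p$-group. The maps $$f\colon\mathrm{Fus}(S)\to\mathrm{Idem}(S),\ \mathcal F\mapsto\omega_{\mathcal F},\qquad g\colon\mathrm{Idem}(S)\to\mathrm{Sys}(S),\ \omega\mapsto\mathrm{Fix}(\omega),\qquad h\colon\mathrm{Fus}(S)\to\mathrm{Sys}(S),\ \mathcal F\mapsto\mathcal S(\mathcal F),$$ are bijections, and $g\circ f=h$.
   Context: Fusion systems: a fusion system on $S$ is a category $\mathcal F$ whose objects are the subgroups of $S$, with composition the usual composition of maps, such that (i) $\mathrm{Hom}_S(P,Q)\subseteq\mathrm{Hom}_{\mathcal F}(P,Q)\subseteq\mathrm{Inj}(P,Q)$ for all $P,Q\le S$ ($\mathrm{Hom}_S$: maps induced by conjugation in $S$; $\mathrm{Inj}$: injective homomorphisms); (ii) if $\phi\in\mathrm{Hom}_{\mathcal F}(P,Q)$ then the isomorphism $P\to\phi(P)$ and its inverse are morphisms in $\mathcal F$. $\mathrm{Fus}(S)$ is the set of fusion systems on $S$. Subgroups: $\Delta_{S,S}$ is the set of subgroups $\Delta(U,\alpha,V)=\{(\alpha(v),v)\mid v\in V\}$ of $S\times S$ with $U,V\le S$, $\alpha\colon V\to U$ an isomorphism; $\Delta(S)=\{(s,s)\mid s\in S\}$; $p_1\colon S\times S\to S$ is the first projection. $L*M=\{(g,k)\mid\exists h\in S:(g,h)\in L,(h,k)\in M\}$, $L^\circ=\{(h,g)\mid(g,h)\in L\}$. $\mathrm{Sys}(S)$ is the set of subsets $\mathcal S\subseteq\Delta_{S,S}$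 that are closed under $S\times S$-conjugation, under taking subgroups, under $*$ and under $L\mapsto L^\circ$, and contain $\Delta(S)$. $\mathcal S(\mathcal F)=\{\Delta(\phi(P),\phi,P)\mid P\le S,\ \phi\in\mathrm{Hom}_{\mathcal F}(P,S)\}$. Double Burnside ring: a $(G,H)$-biset is a finite set with commuting left $G$- and right $H$-action, identified with a left $G\times H$-set via $(g,h)x=gxh^{-1}$; it is bifree if both actions are free. $X\times_HY$ is the set of $H$-orbits of $X\times Y$ under $h(x,y)=(xh^{-1},hy)$. $B^\Delta(G,H)$ is the Grothendieck group (w.r.t. disjoint union) of bifree $(G,H)$-bisets, with $[X]\cdot_H[Y]=[X\times_HY]$; $B^\Delta(S,S)$ is a ring with identity $[S]$. $\Phi_L\colon\mathbb QB^\Delta(S,S)\to\mathbb Q$ is the linear extension of $[X]\mapsto|X^L|$. Frobenius elements: for bifree $(S,S)$-bisets $X,Y$, $X\times Y$ is a bifree $(S\times S,S)$-biset via $(g,h)(x,y)k=(gxk,hyk)$ and a bifree $(S,S\times S)$-biset via $g(x,y)(h,k)=(gxh,gyk)$; this induces bilinear maps $(a,b)\mapsto a\times b$ from $\mathbb QB^\Delta(S,S)\times\mathbb QB^\Delta(S,S)$ to $\mathbb QB^\Delta(S\times S,S)$ and to $\mathbb QB^\Delta(S,S\times S)$. $a\in\mathbb QB^\Delta(S,S)$ is a right Frobenius element if $a\times a=(a\times[S])\cdot_Sa$ in $\mathbb QB^\Delta(S\times S,S)$, a left Frobenius element if $a\times a=a\cdot_S(a\times[S])$ in $\mathbb QB^\Delta(S,S\times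 S)$, and a Frobenius element if both. $\mathrm{Fix}(\omega)=\{L\in\Delta_{S,S}\mid\Phi_L(\omega)\ne0\}$. $\mathrm{Idem}(S)$ is the set of idempotents $\omega\in\mathbb QB^\Delta(S,S)$ that are Frobenius elements, such that $\mathrm{Fix}(\omega)$ is closed under taking subgroups and contains $\Delta(S)$. The element $\omega_{\mathcal F}$: for a fusion system $\mathcal F$, $B^{\mathcal F}(S,S)$ is the span of the $[S\times S/L]$, $L\in\mathcal S(\mathcal F)$; $\tilde{\mathcal F}$ is a transversal of the $\mathcal F$-isomorphism classes of subgroups of $S$; $\overline{\mathrm{Hom}}_{\mathcal F}(P,S)=\mathrm{Inn}(S)\backslash\mathrm{Hom}_{\mathcal F}(P,S)$; $\mathrm{Out}_{\mathcal F}(P)=\mathrm{Aut}_{\mathcal F}(P)/\mathrm{Inn}(P)$. There is a $\mathbb Q$-algebra isomorphism $\tilde\sigma^{\mathcal F}\colon\mathbb QB^{\mathcal F}(S,S)\to\prod_{P\in\tilde{\mathcal F}}\mathrm{End}_{\mathbb Q\mathrm{Out}_{\mathcal F}(P)}(\mathbb Q\overline{\mathrm{Hom}}_{\mathcal F}(P,S))$ with $P$-component $a\mapsto\big([\psi]\mapsto\sum_{[\phi]}\frac{\Phi_{\Delta(\phi(P),\phi\psi^{-1},\psi(P))}(a)}{|C_S(\phi(P))|}[\phi]\big)$, and $\omega_{\mathcal F}$ is the element with $\tilde\sigma^{\mathcal F}(\omega_{\mathcal F})=(\varepsilon_P)_P$, $\varepsilon_P([\psi])=\sum_{[\phi]}\frac{|S|}{|C_S(\phi(P))||\mathrm{Hom}_{\mathcal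 F}(P,S)|}[\phi]$. Equivalently, $\omega_{\mathcal F}$ is the unique element of $\mathbb QB^\Delta(S,S)$ with, for $L\in\Delta_{S,S}$, $\Phi_L(\omega_{\mathcal F})=\frac{|S|}{|\mathrm{Hom}_{\mathcal F}(p_1(L),S)|}$ if $L\in\mathcal S(\mathcal F)$ and $\Phi_L(\omega_{\mathcal F})=0$ otherwise. *)

(* Defs.v *)
From HB Require Import structures.
From mathcomp Require Import boolp classical_sets functions.
From mathcomp Require Import all_boot all_order all_algebra all_fingroup.
From mathcomp Require Import generic_quotient.

Set Implicit Arguments.
Unset Strict Implicit.
Unset Printing Implicit Defensive.

Import GRing.Theory.
Local Open Scope group_scope.
Local Open Scope quotient_scope.

(** A [finGroupType] [G] is used both as a finite group and as the type of its
    elements; its subgroups are the [P : {group G}], and the group itself, seen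
    as one of its subgroups, is [[set: G]%G]. *)

(** * Finite bifree bisets *)

Record biset_on (G H : finGroupType) (X : finType) := BisetOn {
  lact : G -> X -> X;
  ract : X -> H -> X;
  lact1 : forall x, lact 1 x = x;
  lactM : forall g g' x, lact (g * g') x = lact g (lact g' x);
  ract1 : forall x, ract x 1 = x;
  ractM : forall x h h', ract x (h * h') = ract (ract x h) h';
  lractA : forall g x h, lact g (ract x h) = ract (lact g x) h;
  lact_free : forall g x, lact g x = x -> g = 1;
  ract_free : forall x h, ract x h = x -> h = 1 }.

Record biset (G H : finGroupType) := Biset {
  bcar :> finType;
  bstr :> biset_on G H bcar }.

Definition biso (G H : finGroupType) (X Y : biset G H) : Prop :=
  exists f : X -> Y, [/\ bijective f,
    forall g x, f (lact X g x) = lact Y g (f x)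
    & forall x h, f (ract X x h) = ract Y (f x) h].

Section Sum.
Variables (G H : finGroupType) (X Y : biset G H).

Definition sum_lact g (z : X + Y) : X + Y :=
  match z with inl x => inl (lact X g x) | inr y => inr (lact Y g y) end.
Definition sum_ract (z : X + Y) h : X + Y :=
  match z with inl x => inl (ract X x h) | inr y => inr (ract Y y h) end.

Lemma sum_biset_on : biset_on G H (X + Y)%type.
Proof.
exists sum_lact sum_ract.
- by case=> z /=; rewrite lact1.
- by move=> g g' [] z /=; rewrite lactM.
- by case=> z /=; rewrite ract1.
- by case=> z h h' /=; rewrite ractM.
- by move=> g [] z h /=; rewrite lractA.
- by move=> g [] z /= [] /lact_free.
- by move=> [] z h /= [] /ract_free.
Defined.

Definition sum_biset : biset G H := Biset sum_biset_on.
End Sum.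

Lemma biso_refl (G H : finGroupType) (X : biset G H) : biso X X.
Proof. by exists id; split=> //; exists id. Qed.

Lemma biso_sym (G H : finGroupType) (X Y : biset G H) : biso X Y -> biso Y X.
Proof.
case=> f [[f' fK f'K] fl fr]; exists f'; split=> [|g x|x h].
- by exists f.
- by apply: (can_inj fK); rewrite fl !f'K.
- by apply: (can_inj fK); rewrite fr !f'K.
Qed.

Lemma biso_trans (G H : finGroupType) (Y X Z : biset G H) :
  biso X Y -> biso Y Z -> biso X Z.
Proof.
case=> f [bf fl fr] [f' [bf' fl' fr']]; exists (f' \o f); split=> [|g x|x h] /=.
- exact: bij_comp.
- by rewrite fl fl'.
- by rewrite fr fr'.
Qed.

Lemma biso_sum (G H : finGroupType) (X X' Y Y' : biset G H) :
  biso X X' -> biso Y Y' -> biso (sum_biset X Y) (sum_biset X' Y').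
Proof.
case=> f [[f' fK f'K] fl fr] [k [[k' kK k'K] kl kr]].
exists (fun z : X + Y => match z with inl x => inl (f x) | inr y => inr (k y) end).
split=> [|g [] x|[] x h] /=; rewrite ?fl ?kl ?fr ?kr //.
by exists (fun z : X' + Y' => match z with inl x => inl (f' x) | inr y => inr (k' y) end);
  case=> x /=; rewrite ?fK ?f'K ?kK ?k'K.
Qed.

(** [G] with its left and right multiplications. *)
Section Regular.
Variable G : finGroupType.

Lemma regular_biset_on : biset_on G G G.
Proof.
exists (fun g x => g * x) (fun x h => x * h).
- exact: mul1g.
- by move=> g g' x; rewrite mulgA.
- exact: mulg1.
- by move=> g g' x; rewrite mulgA.
- by move=> g g' x; rewrite mulgA.
- by move=> g x /(congr1 (fun y => y * x^-1)); rewrite mulgK mulgV.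
- by move=> x g /(congr1 (fun y => x^-1 * y)); rewrite mulKg mulVg.
Defined.

Definition regular_biset : biset G G := Biset regular_biset_on.
End Regular.

(** [X \times_H Y], the set of orbits of [h (x, y) = (x h^-1, h y)]. *)
Section Tensor.
Variables (G H K : finGroupType) (X : biset G H) (Y : biset H K).

Definition tensor_orbit (z : X * Y) : {set X * Y} :=
  [set (ract X z.1 h^-1, lact Y h z.2) | h : H].

Definition tensor_car : finType := {A : {set X * Y} | A \in codom tensor_orbit}.

Definition tensor_pi (z : X * Y) : tensor_car :=
  exist _ (tensor_orbit z) (codom_f tensor_orbit z).

Lemma tensor_piP (A : tensor_car) : exists z, A = tensor_pi z.
Proof. by case: A => A AP; case/codomP: (AP) => z Az; exists z; apply: val_inj. Qed.

Lemma tensor_pi_eq z z' : tensor_pi z = tensor_pi z' <->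
  exists h, z' = (ract X z.1 h^-1, lact Y h z.2).
Proof.
split=> [/(congr1 val) /= e|[h ->]].
  have : z' \in tensor_orbit z.
    by rewrite e; apply/imsetP; exists 1 => //; rewrite invg1 ract1 lact1 -surjective_pairing.
  by case/imsetP=> h _ ->; exists h.
apply: val_inj; apply/setP => w /=; apply/imsetP/imsetP => -[k _ ->].
  exists (k * h^-1) => //=.
  by rewrite -ractM -lactM mulgKV invMg invgK mulKg.
by exists (k * h) => //=; rewrite -ractM -lactM invMg.
Qed.

Lemma tensor_lact_proof g (A : tensor_car) :
  [set (lact X g z.1, z.2) | z in val A] \in codom tensor_orbit.
Proof.
have [z ->] := tensor_piP A; apply/codomP; exists (lact X g z.1, z.2) => /=.
apply/setP => w; apply/imsetP/imsetP => [[_ /imsetP[h _ ->] ->]|[h _ ->]] /=.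
  by exists h => //; rewrite lractA.
exists (ract X z.1 h^-1, lact Y h z.2) => /=; last by rewrite lractA.
by apply/imsetP; exists h.
Qed.

Lemma tensor_ract_proof (A : tensor_car) k :
  [set (z.1, ract Y z.2 k) | z in val A] \in codom tensor_orbit.
Proof.
have [z ->] := tensor_piP A; apply/codomP; exists (z.1, ract Y z.2 k) => /=.
apply/setP => w; apply/imsetP/imsetP => [[_ /imsetP[h _ ->] ->]|[h _ ->]] /=.
  by exists h => //; rewrite lractA.
exists (ract X z.1 h^-1, lact Y h z.2) => /=; last by rewrite lractA.
by apply/imsetP; exists h.
Qed.

Definition tensor_lact g (A : tensor_car) : tensor_car :=
  exist _ [set (lact X g z.1, z.2) | z in val A] (tensor_lact_proof g A).
Definition tensor_ract (A : tensor_car) k : tensor_car :=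
  exist _ [set (z.1, ract Y z.2 k) | z in val A] (tensor_ract_proof A k).

Lemma tensor_lactE g z : tensor_lact g (tensor_pi z) = tensor_pi (lact X g z.1, z.2).
Proof.
apply: val_inj; apply/setP => w /=.
apply/imsetP/imsetP => [[_ /imsetP[h _ ->] ->]|[h _ ->]] /=.
  by exists h => //; rewrite lractA.
exists (ract X z.1 h^-1, lact Y h z.2) => /=; last by rewrite lractA.
by apply/imsetP; exists h.
Qed.

Lemma tensor_ractE z k : tensor_ract (tensor_pi z) k = tensor_pi (z.1, ract Y z.2 k).
Proof.
apply: val_inj; apply/setP => w /=.
apply/imsetP/imsetP => [[_ /imsetP[h _ ->] ->]|[h _ ->]] /=.
  by exists h => //; rewrite lractA.
exists (ract X z.1 h^-1, lact Y h z.2) => /=; last by rewrite lractA.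
by apply/imsetP; exists h.
Qed.

Lemma tensor_biset_on : biset_on G K tensor_car.
Proof.
exists tensor_lact tensor_ract.
- by move=> A; have [[x y] ->] := tensor_piP A; rewrite tensor_lactE lact1.
- by move=> g g' A; have [[x y] ->] := tensor_piP A; rewrite !tensor_lactE lactM.
- by move=> A; have [[x y] ->] := tensor_piP A; rewrite tensor_ractE ract1.
- by move=> A k k'; have [[x y] ->] := tensor_piP A; rewrite !tensor_ractE ractM.
- by move=> g A k; have [[x y] ->] := tensor_piP A;
     rewrite !(tensor_ractE, tensor_lactE).
- move=> g A; have [[x y] ->] := tensor_piP A; rewrite tensor_lactE.
  case/tensor_pi_eq=> h /= [ex /esym/lact_free eh].
  by move: ex; rewrite eh invg1 ract1 => /esym/lact_free.
- move=> A k; have [[x y] ->] := tensor_piP A; rewrite tensor_ractE.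
  case/tensor_pi_eq=> h /= [/esym/ract_free/eqP]; rewrite invg_eq1 => /eqP ->.
  by rewrite lact1 => /esym/ract_free.
Defined.

Definition tensor_biset : biset G K := Biset tensor_biset_on.
End Tensor.

Section TensorIso.
Variables G H K : finGroupType.
Implicit Types (X : biset G H) (Y : biset H K).

Lemma tensor_iso X Y (W : biset G K) (f : X * Y -> W) :
    (forall w, exists z, f z = w) ->
    (forall z z', f z = f z' <->
       exists h, z' = (ract X z.1 h^-1, lact Y h z.2)) ->
    (forall g z, f (lact X g z.1, z.2) = lact W g (f z)) ->
    (forall z k, f (z.1, ract Y z.2 k) = ract W (f z) k) ->
  biso (tensor_biset X Y) W.
Proof.
move=> fs fi fl fr.
have ex (A : tensor_car X Y) : exists z, A == tensor_pi z.
  by have [z ->] := tensor_piP A; exists z.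
pose F (A : tensor_car X Y) := f (xchoose (ex A)).
have FE z : F (tensor_pi z) = f z.
  by apply/fi/tensor_pi_eq; rewrite -(eqP (xchooseP (ex (tensor_pi z)))).
have [z0 z0P] := choice fs.
exists F; split.
- exists (fun w => tensor_pi (z0 w)) => [A|w]; last by rewrite FE z0P.
  have [z ->] := tensor_piP A; rewrite FE.
  by apply/tensor_pi_eq/fi; rewrite z0P.
- by move=> g A; have [z ->] := tensor_piP A; rewrite [lact _ _ _]tensor_lactE !FE fl.
- by move=> A k; have [z ->] := tensor_piP A; rewrite [ract _ _ _]tensor_ractE !FE fr.
Qed.

Lemma tensor_biso X X' Y Y' : biso X X' -> biso Y Y' ->
  biso (tensor_biset X Y) (tensor_biset X' Y').
Proof.
case=> f [[f' fK f'K] fl fr] [k [[k' kK k'K] kl kr]].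
apply: (tensor_iso (f := fun z => tensor_pi (f z.1, k z.2) : tensor_biset X' Y')).
- move=> A; have [[x y] ->] := tensor_piP A.
  by exists (f' x, k' y); rewrite /= f'K k'K.
- move=> [x y] [x' y']; rewrite tensor_pi_eq /=; split=> -[h] [].
    move=> e1 e2; exists h; rewrite -fr in e1; rewrite -kl in e2.
    by rewrite (can_inj fK e1) (can_inj kK e2).
  by move=> -> ->; exists h; rewrite fr kl.
- by move=> g z; rewrite [RHS]tensor_lactE fl.
- by move=> z g; rewrite [RHS]tensor_ractE kr.
Qed.

Lemma tensor_suml X X' Y :
  biso (tensor_biset (sum_biset X X') Y)
       (sum_biset (tensor_biset X Y) (tensor_biset X' Y)).
Proof.
pose f (z : (X + X') * Y) : tensor_car X Y + tensor_car X' Y := match z.1 with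
  | inl x => inl (tensor_pi (x, z.2)) | inr x => inr (tensor_pi (x, z.2)) end.
apply: (@tensor_iso (sum_biset X X') Y
          (sum_biset (tensor_biset X Y) (tensor_biset X' Y)) f).
- case=> A; have [[x y] ->] := tensor_piP A; first by exists (inl x, y).
  by exists (inr x, y).
- move=> [[]x y] [[]x' y']; rewrite /f /=.
  + split=> [/(@inl_inj _ _ _ _)/tensor_pi_eq[h /= [-> ->]]|[h [-> ->]]]; first by exists h.
    by congr inl; apply/tensor_pi_eq; exists h.
  + by split=> // -[h []].
  + by split=> // -[h []].
  + split=> [/(@inr_inj _ _ _ _)/tensor_pi_eq[h /= [-> ->]]|[h [-> ->]]]; first by exists h.
    by congr inr; apply/tensor_pi_eq; exists h.
- by move=> g [[]x y] /=; rewrite tensor_lactE.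
- by move=> [[]x y] k /=; rewrite tensor_ractE.
Qed.

Lemma tensor_sumr X Y Y' :
  biso (tensor_biset X (sum_biset Y Y'))
       (sum_biset (tensor_biset X Y) (tensor_biset X Y')).
Proof.
pose f (z : X * (Y + Y')) : tensor_car X Y + tensor_car X Y' := match z.2 with
  | inl y => inl (tensor_pi (z.1, y)) | inr y => inr (tensor_pi (z.1, y)) end.
apply: (@tensor_iso X (sum_biset Y Y')
          (sum_biset (tensor_biset X Y) (tensor_biset X Y')) f).
- case=> A; have [[x y] ->] := tensor_piP A; first by exists (x, inl y).
  by exists (x, inr y).
- move=> [x []y] [x' []y']; rewrite /f /=.
  + split=> [/(@inl_inj _ _ _ _)/tensor_pi_eq[h /= [-> ->]]|[h [-> ->]]]; first by exists h.
    by congr inl; apply/tensor_pi_eq; exists h.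
  + by split=> // -[h []].
  + by split=> // -[h []].
  + split=> [/(@inr_inj _ _ _ _)/tensor_pi_eq[h /= [-> ->]]|[h [-> ->]]]; first by exists h.
    by congr inr; apply/tensor_pi_eq; exists h.
- by move=> g [x []y] /=; rewrite tensor_lactE.
- by move=> [x []y] k /=; rewrite tensor_ractE.
Qed.
End TensorIso.

(** The two biset structures on [X * Y] for [(S,S)]-bisets [X] and [Y]: an
    [(S \times S, S)]-biset and an [(S, S \times S)]-biset. *)
Section Cross.
Variables (S : finGroupType) (X Y : biset S S).

Lemma crossl_biset_on : biset_on (S * S)%type S (X * Y)%type.
Proof.
exists (fun g z => (lact X g.1 z.1, lact Y g.2 z.2))
       (fun z k => (ract X z.1 k, ract Y z.2 k)).
- by case=> x y; rewrite /= !lact1.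
- by move=> g g' [x y]; rewrite /= !lactM.
- by case=> x y; rewrite /= !ract1.
- by move=> [x y] k k'; rewrite /= !ractM.
- by move=> g [x y] k; rewrite /= !lractA.
- by move=> [g h] [x y] [] /lact_free /= -> /lact_free ->.
- by move=> [x y] k [] /ract_free.
Defined.

Lemma crossr_biset_on : biset_on S (S * S)%type (X * Y)%type.
Proof.
exists (fun g z => (lact X g z.1, lact Y g z.2))
       (fun z k => (ract X z.1 k.1, ract Y z.2 k.2)).
- by case=> x y; rewrite /= !lact1.
- by move=> g g' [x y]; rewrite /= !lactM.
- by case=> x y; rewrite /= !ract1.
- by move=> [x y] k k'; rewrite /= !ractM.
- by move=> g [x y] k; rewrite /= !lractA.
- by move=> g [x y] [] /lact_free.
- by move=> [x y] [h k] [] /ract_free /= -> /ract_free ->.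
Defined.

Definition crossl_biset : biset (S * S)%type S := Biset crossl_biset_on.
Definition crossr_biset : biset S (S * S)%type := Biset crossr_biset_on.
End Cross.

Section CrossIso.
Variable S : finGroupType.
Implicit Types X Y : biset S S.

Lemma crossl_biso X X' Y Y' : biso X X' -> biso Y Y' ->
  biso (crossl_biset X Y) (crossl_biset X' Y').
Proof.
case=> f [[f' fK f'K] fl fr] [k [[k' kK k'K] kl kr]].
exists (fun z => (f z.1, k z.2)); split=> [|g [x y]|[x y] g] /=;
  rewrite ?fl ?kl ?fr ?kr //.
by exists (fun z => (f' z.1, k' z.2)); case=> x y /=; rewrite ?fK ?kK ?f'K ?k'K.
Qed.

Lemma crossr_biso X X' Y Y' : biso X X' -> biso Y Y' ->
  biso (crossr_biset X Y) (crossr_biset X' Y').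
Proof.
case=> f [[f' fK f'K] fl fr] [k [[k' kK k'K] kl kr]].
exists (fun z => (f z.1, k z.2)); split=> [|g [x y]|[x y] g] /=;
  rewrite ?fl ?kl ?fr ?kr //.
by exists (fun z => (f' z.1, k' z.2)); case=> x y /=; rewrite ?fK ?kK ?f'K ?k'K.
Qed.

Definition distrl (A B C : Type) (z : (A + B) * C) : A * C + B * C :=
  match z.1 with inl x => inl (x, z.2) | inr x => inr (x, z.2) end.
Definition distrr (A B C : Type) (z : A * (B + C)) : A * B + A * C :=
  match z.2 with inl y => inl (z.1, y) | inr y => inr (z.1, y) end.

Lemma distrl_bij (A B C : Type) : bijective (@distrl A B C).
Proof.
exists (fun z => match z with inl u => (inl u.1, u.2) | inr u => (inr u.1, u.2) end).
  by case=> -[].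
by case=> -[].
Qed.
Lemma distrr_bij (A B C : Type) : bijective (@distrr A B C).
Proof.
exists (fun z => match z with inl u => (u.1, inl u.2) | inr u => (u.1, inr u.2) end).
  by case=> x [].
by case=> -[].
Qed.

Lemma crossl_suml X X' Y : biso (crossl_biset (sum_biset X X') Y)
  (sum_biset (crossl_biset X Y) (crossl_biset X' Y)).
Proof.
by exists (@distrl X X' Y); split=> [|g [[]]|[[]]] //; exact: distrl_bij.
Qed.
Lemma crossl_sumr X Y Y' : biso (crossl_biset X (sum_biset Y Y'))
  (sum_biset (crossl_biset X Y) (crossl_biset X Y')).
Proof.
by exists (@distrr X Y Y'); split=> [|g [x []]|[x []]] //; exact: distrr_bij.
Qed.
Lemma crossr_suml X X' Y : biso (crossr_biset (sum_biset X X') Y)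
  (sum_biset (crossr_biset X Y) (crossr_biset X' Y)).
Proof.
by exists (@distrl X X' Y); split=> [|g [[]]|[[]]] //; exact: distrl_bij.
Qed.
Lemma crossr_sumr X Y Y' : biso (crossr_biset X (sum_biset Y Y'))
  (sum_biset (crossr_biset X Y) (crossr_biset X Y')).
Proof.
by exists (@distrr X Y Y'); split=> [|g [x []]|[x []]] //; exact: distrr_bij.
Qed.
End CrossIso.

(** * Twisted diagonal subgroups *)

Definition Delta (G H : finGroupType) (a : H -> G) (V : {set H}) : {set G * H} :=
  [set (a v, v) | v in V].

(** [L] belongs to [Delta_{G,H}]. *)
Definition twisted (G H : finGroupType) (L : {set G * H}) : Prop :=
  exists (U : {group G}) (V : {group H}) (a : {morphism V >-> G}),
    isom V U a /\ L = Delta a V.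

(** [G \times H / L] as a biset, via [g x h = (g, h^-1) x]. *)
Section CosetBiset.
Variables (G H : finGroupType) (L : {group G * H}).
Hypothesis twL : twisted L.

Definition coset_car : finType := {A : {set G * H} | A \in lcosets L setT}.

Lemma coset_proof (z : G * H) (A : coset_car) : z *: val A \in lcosets L setT.
Proof.
case: A => A /= /lcosetsP[w _ ->]; rewrite -lcosetM; apply/lcosetsP.
by exists (z * w); rewrite ?inE.
Qed.

Definition coset_act (z : G * H) (A : coset_car) : coset_car :=
  exist _ (z *: val A) (coset_proof z A).

Lemma coset_actM z z' A : coset_act (z * z') A = coset_act z (coset_act z' A).
Proof. by apply: val_inj; rewrite /= lcosetM. Qed.

Lemma coset_act1 A : coset_act 1 A = A.
Proof. by apply: val_inj; rewrite /= lcoset1. Qed.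

Lemma coset_act_fix z A : coset_act z A = A -> exists w, z ^ w \in L.
Proof.
case: A => A AP /(congr1 val) /=; case/lcosetsP: (AP) => w _ -> e.
exists w; have: z * w \in w *: L by rewrite -e -lcosetM lcoset_refl.
by rewrite mem_lcoset conjgE.
Qed.

Lemma twisted_fst1 z : z \in (L : {set G * H}) -> z.1 = 1 -> z = 1.
Proof.
have [U [V [a [/isomP[ia _] ->]]]] := twL.
case/imsetP=> v vV -> /= av; suff -> : v = 1 by rewrite morph1.
by apply: (injmP ia) => //; rewrite morph1.
Qed.

Lemma twisted_snd1 z : z \in (L : {set G * H}) -> z.2 = 1 -> z = 1.
Proof.
have [U [V [a [_ ->]]]] := twL.
by case/imsetP=> v vV -> /= ->; rewrite morph1.
Qed.

Lemma coset_biset_on : biset_on G H coset_car.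
Proof.
exists (fun g A => coset_act (g, 1) A) (fun A h => coset_act (1, h^-1) A).
- exact: coset_act1.
- by move=> g g' A; rewrite -coset_actM; congr coset_act; congr pair; rewrite mulg1.
- by move=> A; rewrite invg1; apply: coset_act1.
- by move=> A h h'; rewrite -coset_actM; congr coset_act; congr pair;
     rewrite ?invMg ?mulg1.
- by move=> g A h; rewrite -!coset_actM; congr coset_act; congr pair;
     rewrite ?mulg1 ?mul1g.
- move=> g A /coset_act_fix[[x y] /twisted_snd1 e].
  have /(congr1 fst) : (g, 1) ^ (x, y) = 1 by apply: e; exact: conj1g.
  by move/eqP; rewrite [_.1](_ : _ = g ^ x) // conjg_eq1 => /eqP.
- move=> A h /coset_act_fix[[x y] /twisted_fst1 e].
  have /(congr1 snd) : (1, h^-1) ^ (x, y) = 1 by apply: e; exact: conj1g.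
  by move/eqP; rewrite [_.2](_ : _ = h^-1 ^ y) // conjg_eq1 invg_eq1 => /eqP.
Defined.

Definition coset_biset : biset G H := Biset coset_biset_on.
End CosetBiset.

(** * The double Burnside algebra [Q B^Delta(G, H)]

    The rational Grothendieck group is presented by generators and relations:
    the generators are the finite bifree bisets, and the relations identify
    isomorphic bisets and [X + Y] with the disjoint union of [X] and [Y].  To
    have a small set of generators these are taken with underlying set some
    ['I_n], which meets every isomorphism class; [[X]] makes sense for every
    finite bifree biset [X] through transport along [X ~ 'I_#|X|]. *)

Record obiset (G H : finGroupType) := OBiset {
  odeg : nat;
  ostr : biset_on G H 'I_odeg }.
HB.instance Definition _ (G H : finGroupType) := gen_eqMixin (obiset G H).
HB.instance Definition _ (G H : finGroupType) := gen_choiceMixin (obiset G H).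

Coercion biset_of_obiset (G H : finGroupType) (X : obiset G H) : biset G H :=
  Biset (ostr X).

Section Transport.
Variables (G H : finGroupType) (X : biset G H).

Lemma ord_biset_on : biset_on G H 'I_#|X|.
Proof.
exists (fun g i => enum_rank (lact X g (enum_val i)))
       (fun i h => enum_rank (ract X (enum_val i) h)).
- by move=> i; rewrite lact1 enum_valK.
- by move=> g g' i; rewrite enum_rankK lactM.
- by move=> i; rewrite ract1 enum_valK.
- by move=> i h h'; rewrite enum_rankK ractM.
- by move=> g i h; rewrite !enum_rankK lractA.
- by move=> g i /(congr1 enum_val); rewrite enum_rankK => /lact_free.
- by move=> i h /(congr1 enum_val); rewrite enum_rankK => /ract_free.
Defined.

Definition ord_biset : obiset G H := OBiset ord_biset_on.

Lemma ord_biset_iso : biso X ord_biset.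
Proof.
exists enum_rank; split=> [|g x|x h] /=; last by rewrite enum_rankK.
  by exists enum_val; [exact: enum_rankK|exact: enum_valK].
by rewrite enum_rankK.
Qed.
End Transport.

(** Formal [Q]-linear combinations of bisets, and equality of two of them as
    elements of [Q B^Delta(G, H)]. *)
Definition formal (G H : finGroupType) := seq (rat * obiset G H).

Inductive formal_eq (G H : finGroupType) : formal G H -> formal G H -> Prop :=
| FErefl u : formal_eq u u
| FEsym u v : formal_eq u v -> formal_eq v u
| FEtrans u v w : formal_eq u v -> formal_eq v w -> formal_eq u w
| FEcat u u' v v' :
    formal_eq u u' -> formal_eq v v' -> formal_eq (u ++ v) (u' ++ v')
| FEcatC u v : formal_eq (u ++ v) (v ++ u)
| FEzero X : formal_eq [:: (0%R, X)] [::]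
| FEadd a b X : formal_eq [:: (a, X); (b, X)] [:: ((a + b)%R, X)]
| FEiso a (X Y : obiset G H) : biso X Y -> formal_eq [:: (a, X)] [:: (a, Y)]
| FEsum a (X Y Z : obiset G H) : biso Z (sum_biset X Y) ->
    formal_eq [:: (a, Z)] [:: (a, X); (a, Y)].

Section QB.
Variables G H : finGroupType.
Implicit Types u v w : formal G H.

Definition formal_eqb u v : bool := `[< formal_eq u v >].

Lemma formal_eqb_refl : reflexive formal_eqb.
Proof. by move=> u; apply/asboolP; exact: FErefl. Qed.
Lemma formal_eqb_sym : symmetric formal_eqb.
Proof. by move=> u v; apply/asboolP/asboolP; exact: FEsym. Qed.
Lemma formal_eqb_trans : transitive formal_eqb.
Proof. by move=> v u w /asboolP uv /asboolP vw; apply/asboolP; exact: FEtrans vw. Qed.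

Canonical formal_equiv :=
  EquivRel formal_eqb formal_eqb_refl formal_eqb_sym formal_eqb_trans.

Definition QB := {eq_quot formal_equiv}.
HB.instance Definition _ := EqQuotient.on QB.
HB.instance Definition _ := Choice.on QB.

Lemma qb_eqP u v : (\pi_QB u = \pi_QB v) <-> formal_eq u v.
Proof. by split=> [/eqmodP/asboolP|e]; last by apply/eqmodP/asboolP. Qed.

Lemma formal_eq_repr u : formal_eq (repr (\pi_QB u)) u.
Proof. by apply/qb_eqP; rewrite reprK. Qed.

Definition fscale (c : rat) u : formal G H := [seq ((c * q.1)%R, q.2) | q <- u].

Lemma formal_eq_scale c u v : formal_eq u v -> formal_eq (fscale c u) (fscale c v).
Proof.
elim=> {u v} [u|u v _ IH|u v w _ IH1 _ IH2|u u' v v' _ IH1 _ IH2|u v|X|a b X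
             |a X Y XY|a X Y Z XYZ] /=.
- exact: FErefl.
- exact: FEsym.
- exact: FEtrans IH2.
- by rewrite /fscale !map_cat; apply: FEcat.
- by rewrite /fscale !map_cat; apply: FEcatC.
- by rewrite mulr0; apply: FEzero.
- by rewrite mulrDr; apply: FEadd.
- exact: FEiso.
- exact: FEsum.
Qed.

Lemma fscale0 u : formal_eq (fscale 0%R u) [::].
Proof.
elim: u => [|[a X] u IH] /=; first exact: FErefl.
by rewrite mul0r; apply: (FEcat (u := [:: (0%R, X)]) (u' := [::])) => //; exact: FEzero.
Qed.

Lemma fscaleDl a b u :
  formal_eq (fscale (a + b)%R u) (fscale a u ++ fscale b u).
Proof.
elim: u => [|[c X] u IH] /=; first exact: FErefl.
set x := ((a * c)%R, X); set y := ((b * c)%R, X).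
apply: (FEtrans (v := [:: x; y] ++ (fscale a u ++ fscale b u))).
  by rewrite mulrDl -cat1s; apply: FEcat IH; apply/FEsym/FEadd.
rewrite -[X in formal_eq _ X]/(([:: x] ++ fscale a u) ++ ([:: y] ++ fscale b u)).
rewrite -[[:: x; y]]/([:: x] ++ [:: y]) -!catA; apply: FEcat; first exact: FErefl.
rewrite !catA; apply: FEcat; last exact: FErefl.
exact: FEcatC.
Qed.

Definition qb_add (x y : QB) : QB := \pi_QB (repr x ++ repr y).
Definition qb_scale (c : rat) (x : QB) : QB := \pi_QB (fscale c (repr x)).
Definition qb_opp : QB -> QB := qb_scale (-1)%R.
Definition qb_zero : QB := \pi_QB [::].

Lemma qb_addE u v : qb_add (\pi_QB u) (\pi_QB v) = \pi_QB (u ++ v).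
Proof. by apply/qb_eqP; apply: FEcat; exact: formal_eq_repr. Qed.
Lemma qb_scaleE c u : qb_scale c (\pi_QB u) = \pi_QB (fscale c u).
Proof. by apply/qb_eqP/formal_eq_scale/formal_eq_repr. Qed.

Lemma qb_repr (x : QB) : exists u, x = \pi_QB u.
Proof. by exists (repr x); rewrite reprK. Qed.

Lemma qb_addA : associative qb_add.
Proof.
move=> x y z; have [[u ->] [v ->] [w ->]] := And3 (qb_repr x) (qb_repr y) (qb_repr z).
by rewrite !qb_addE catA.
Qed.
Lemma qb_addC : commutative qb_add.
Proof.
move=> x y; have [[u ->] [v ->]] := conj (qb_repr x) (qb_repr y).
by rewrite !qb_addE; apply/qb_eqP/FEcatC.
Qed.
Lemma qb_add0 : left_id qb_zero qb_add.
Proof. by move=> x; have [u ->] := qb_repr x; rewrite qb_addE. Qed.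
Lemma qb_scaleA a b x : qb_scale a (qb_scale b x) = qb_scale (a * b)%R x.
Proof.
have [u ->] := qb_repr x; rewrite !qb_scaleE /fscale -map_comp.
by congr \pi_QB; apply: eq_map => q /=; rewrite mulrA.
Qed.
Lemma qb_scale1 : left_id 1%R qb_scale.
Proof.
move=> x; have [u ->] := qb_repr x; rewrite qb_scaleE /fscale; congr \pi_QB.
by rewrite -[RHS]map_id; apply: eq_map => -[a X] /=; rewrite mul1r.
Qed.
Lemma qb_scaleDr : right_distributive qb_scale qb_add.
Proof.
move=> c x y; have [[u ->] [v ->]] := conj (qb_repr x) (qb_repr y).
by rewrite !(qb_addE, qb_scaleE) /fscale map_cat.
Qed.
Lemma qb_scaleDl x : {morph qb_scale^~ x : a b / (a + b)%R >-> qb_add a b}.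
Proof.
move=> a b; have [u ->] := qb_repr x.
by rewrite !(qb_addE, qb_scaleE); apply/qb_eqP/fscaleDl.
Qed.
Lemma qb_addN : left_inverse qb_zero qb_opp qb_add.
Proof.
move=> x; rewrite -[X in qb_add _ X]qb_scale1 -qb_scaleDl addNr.
by have [u ->] := qb_repr x; rewrite qb_scaleE; apply/qb_eqP/fscale0.
Qed.

HB.instance Definition _ := GRing.isZmodule.Build QB qb_addA qb_addC qb_add0 qb_addN.
HB.instance Definition _ :=
  GRing.Zmodule_isLmodule.Build rat QB qb_scaleA qb_scale1 qb_scaleDr qb_scaleDl.

(** The class [[X]]. *)
Definition cls (X : biset G H) : QB := \pi_QB [:: (1%R, ord_biset X)].

(** The [Q]-linear extension of [F] to [Q B^Delta(G, H)].  It is independent of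
    the representative [repr x] as soon as [F] is additive: see [qb_lift_cls]
    and [qb_lift_linear]. *)
Definition qb_lift (V : lmodType rat) (F : biset G H -> V) (x : QB) : V :=
  (\sum_(q <- repr x) q.1 *: F q.2)%R.

Definition additive_inv (V : lmodType rat) (F : biset G H -> V) : Prop :=
  (forall X Y, biso X Y -> F X = F Y) /\
  (forall X Y Z, biso Z (sum_biset X Y) -> F Z = (F X + F Y)%R).

Section Lift.
Variables (V : lmodType rat) (F : biset G H -> V) (addF : additive_inv F).

Lemma formal_sum_eq u v : formal_eq u v ->
  (\sum_(q <- u) q.1 *: F q.2 = \sum_(q <- v) q.1 *: F q.2)%R.
Proof.
have [isoF sumF] := addF.
elim=> {u v} [u|u v _ ->|u v w _ -> _ ->|u u' v v' _ IH1 _ IH2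
   |u v|X|a b X|a X Y XY|a X Y Z XYZ] //=.
- by rewrite !big_cat /= IH1 IH2.
- by rewrite !big_cat /= addrC.
- by rewrite big_cons !big_nil scale0r addr0.
- by rewrite !big_cons !big_nil /= !addr0 scalerDl.
- by rewrite !big_cons !big_nil /= (isoF _ _ XY).
- by rewrite !big_cons !big_nil /= (sumF _ _ _ XYZ) scalerDr !addr0.
Qed.

Lemma qb_lift_pi u : qb_lift F (\pi_QB u) = (\sum_(q <- u) q.1 *: F q.2)%R.
Proof. exact/formal_sum_eq/formal_eq_repr. Qed.

Lemma qb_lift_cls X : qb_lift F (cls X) = F X.
Proof.
rewrite /cls qb_lift_pi big_cons big_nil /= scale1r addr0.
by rewrite (proj1 addF _ _ (ord_biset_iso X)).
Qed.

Lemma qb_lift_linear c x y : qb_lift F (c *: x + y)%R = (c *: qb_lift F x + qb_lift F y)%R.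
Proof.
have [[u ->] [v ->]] := conj (qb_repr x) (qb_repr y).
rewrite [(c *: _)%R]qb_scaleE [(_ + _)%R]qb_addE !qb_lift_pi big_cat /=; congr (_ + _)%R.
by rewrite big_map scaler_sumr; apply: eq_bigr => q _; rewrite scalerA.
Qed.
End Lift.
End QB.

Lemma cls_additive (G H : finGroupType) : additive_inv (@cls G H).
Proof.
split=> [X Y XY|X Y Z XYZ].
  apply/qb_eqP/FEiso; apply: biso_trans (ord_biset_iso Y).
  by apply: biso_trans XY; apply/biso_sym/ord_biset_iso.
rewrite [(_ + _)%R]qb_addE; apply/qb_eqP/FEsum.
apply: biso_trans (biso_sum (ord_biset_iso X) (ord_biset_iso Y)).
by apply: biso_trans XYZ; apply/biso_sym/ord_biset_iso.
Qed.

(** Bilinear extension of a binary operation on bisets. *)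
Section Bilinear.
Variables (G H G' H' : finGroupType) (V : lmodType rat).
Variable F : biset G H -> biset G' H' -> V.

Definition qb_lift2 (a : QB G H) (b : QB G' H') : V :=
  qb_lift (fun X => qb_lift (F X) b) a.

Lemma qb_lift2_cls X Y :
    (forall Y', additive_inv (F^~ Y')) -> (forall X', additive_inv (F X')) ->
  qb_lift2 (cls X) (cls Y) = F X Y.
Proof.
move=> Fl Fr; rewrite /qb_lift2 qb_lift_cls ?qb_lift_cls //.
split=> [X1 X2 X12|X1 X2 Z XZ].
  by apply: eq_bigr => q _; congr (_ *: _)%R; apply: (proj1 (Fl q.2)).
rewrite /qb_lift -big_split; apply: eq_bigr => q _ /=.
by rewrite (proj2 (Fl q.2) _ _ _ XZ) scalerDr.
Qed.
End Bilinear.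

Section Operations.
Variables G H K : finGroupType.

Definition qb_mul (a : QB G H) (b : QB H K) : QB G K :=
  qb_lift2 (fun X Y => cls (tensor_biset X Y)) a b.

(** [X^L], with [(g, h) x = g x h^-1]. *)
Definition fixpoints (L : {set G * H}) (X : biset G H) : {set X} :=
  [set x | [forall z in L, ract X (lact X z.1 x) z.2^-1 == x]].

Definition Phi (L : {set G * H}) (a : QB G H) : rat :=
  qb_lift (fun X => (#|fixpoints L X|%:R : rat^o)%R) a.

Lemma qb_mul_cls X Y : qb_mul (cls X) (cls Y) = cls (tensor_biset X Y).
Proof.
apply: (qb_lift2_cls (F := fun X Y => cls (tensor_biset X Y))) => [{}Y|{}X];
  split=> [X1 X2 X12|X1 X2 Z XZ] /=.
- by apply: (proj1 (@cls_additive _ _)); apply: tensor_biso (biso_refl _).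
- apply: (proj2 (@cls_additive _ _)); apply: biso_trans (tensor_suml _ _ _).
  exact: tensor_biso (biso_refl _).
- by apply: (proj1 (@cls_additive _ _)); apply: tensor_biso (biso_refl _) _.
- apply: (proj2 (@cls_additive _ _)); apply: biso_trans (tensor_sumr _ _ _).
  exact: tensor_biso (biso_refl _) _.
Qed.

Lemma Phi_cls L X : Phi L (cls X) = #|fixpoints L X|%:R%R.
Proof.
have card_iso (Y Z : biset G H) : biso Y Z -> #|fixpoints L Y| = #|fixpoints L Z|.
  case=> f [bf fl fr]; rewrite -(on_card_preimset (f := f) (onW_bij _ bf)).
  apply: eq_card => y; rewrite !inE; apply: eq_forallb_in => z _.
  by rewrite -fl -fr (inj_eq (bij_inj bf)).
apply: (qb_lift_cls (F := fun X => (#|fixpoints L X|%:R : rat^o)%R)).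
split=> [Y Z /card_iso -> //|Y Y' Z /card_iso ->].
rewrite -natrD; congr (_%:R)%R.
rewrite -!sum1dep_card big_sumType /=; congr addn; apply: eq_bigl => y;
  by rewrite !inE.
Qed.
End Operations.

Section Frobenius.
Variable S : finGroupType.
Implicit Types a b : QB S S.

Definition qb_crossl a b : QB (S * S)%type S :=
  qb_lift2 (fun X Y => cls (crossl_biset X Y)) a b.
Definition qb_crossr a b : QB S (S * S)%type :=
  qb_lift2 (fun X Y => cls (crossr_biset X Y)) a b.

Lemma qb_crossl_cls X Y : qb_crossl (cls X) (cls Y) = cls (crossl_biset X Y).
Proof.
apply: (qb_lift2_cls (F := fun X Y => cls (crossl_biset X Y))) => [{}Y|{}X];
  split=> [X1 X2 X12|X1 X2 Z XZ] /=.
- by apply: (proj1 (@cls_additive _ _)); apply: crossl_biso (biso_refl _).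
- apply: (proj2 (@cls_additive _ _)); apply: biso_trans (crossl_suml _ _ _).
  exact: crossl_biso (biso_refl _).
- by apply: (proj1 (@cls_additive _ _)); apply: crossl_biso (biso_refl _) _.
- apply: (proj2 (@cls_additive _ _)); apply: biso_trans (crossl_sumr _ _ _).
  exact: crossl_biso (biso_refl _) _.
Qed.

Lemma qb_crossr_cls X Y : qb_crossr (cls X) (cls Y) = cls (crossr_biset X Y).
Proof.
apply: (qb_lift2_cls (F := fun X Y => cls (crossr_biset X Y))) => [{}Y|{}X];
  split=> [X1 X2 X12|X1 X2 Z XZ] /=.
- by apply: (proj1 (@cls_additive _ _)); apply: crossr_biso (biso_refl _).
- apply: (proj2 (@cls_additive _ _)); apply: biso_trans (crossr_suml _ _ _).
  exact: crossr_biso (biso_refl _).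
- by apply: (proj1 (@cls_additive _ _)); apply: crossr_biso (biso_refl _) _.
- apply: (proj2 (@cls_additive _ _)); apply: biso_trans (crossr_sumr _ _ _).
  exact: crossr_biso (biso_refl _) _.
Qed.

Definition qb_one : QB S S := cls (regular_biset S).

Definition right_frobenius a : Prop :=
  qb_crossl a a = qb_mul (qb_crossl a qb_one) a.
Definition left_frobenius a : Prop :=
  qb_crossr a a = qb_mul a (qb_crossr a qb_one).
Definition frobenius a : Prop := right_frobenius a /\ left_frobenius a.
End Frobenius.

(** * Systems of twisted diagonal subgroups *)

Section Systems.
Variable S : finGroupType.

Definition star (L M : {set S * S}) : {set S * S} :=
  [set z | [exists h, ((z.1, h) \in L) && ((h, z.2) \in M)]].
Definition opp_set (L : {set S * S}) : {set S * S} := [set (z.2, z.1) | z in L].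
Definition diag : {set S * S} := [set (s, s) | s : S].

Lemma star_group_set (L M : {group S * S}) : group_set (star L M).
Proof.
apply/group_setP; split=> [|[g k] [g' k']]; rewrite !inE.
  by apply/existsP; exists 1; rewrite !group1.
case/existsP=> h /andP[/= gh hk] /existsP[h' /andP[/= gh' hk']].
apply/existsP; exists (h * h'); apply/andP.
by split; [exact: (groupM gh gh')|exact: (groupM hk hk')].
Qed.
Canonical star_group L M := Group (star_group_set L M).

Lemma opp_group_set (L : {group S * S}) : group_set (opp_set L).
Proof.
apply/group_setP; split=> [|_ _ /imsetP[[g h] gh ->] /imsetP[[g' h'] gh' ->]].
  by apply/imsetP; exists 1; rewrite ?group1.
by apply/imsetP; exists ((g, h) * (g', h')); rewrite ?groupM.
Qed.
Canonical opp_group L := Group (opp_group_set L).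

Lemma diag_group_set : group_set diag.
Proof.
apply/group_setP; split=> [|_ _ /imsetP[s _ ->] /imsetP[t _ ->]].
  by apply/imsetP; exists 1.
by apply/imsetP; exists (s * t).
Qed.
Canonical diag_group := Group diag_group_set.

Definition subgroup_closed (A : {set {group S * S}}) : Prop :=
  forall L M : {group S * S}, L \in A -> M \subset L -> M \in A.

Record is_system (A : {set {group S * S}}) : Prop := IsSystem {
  sys_twisted : forall L : {group S * S}, L \in A -> twisted L;
  sys_conj : forall (L : {group S * S}) z, L \in A -> (L :^ z)%G \in A;
  sys_sub : subgroup_closed A;
  sys_star : forall L M : {group S * S}, L \in A -> M \in A -> star_group L M \in A;
  sys_opp : forall L : {group S * S}, L \in A -> opp_group L \in A;
  sys_diag : diag_group \in A }.

Definition Sys : set {set {group S * S}} := is_system.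

Definition FixSet (a : QB S S) : {set {group S * S}} :=
  [set L : {group S * S} | `[< twisted L >] && (Phi L a != 0%R)].

Record is_idem (a : QB S S) : Prop := IsIdem {
  idem_mul : qb_mul a a = a;
  idem_frobenius : frobenius a;
  idem_sub : subgroup_closed (FixSet a);
  idem_diag : diag_group \in FixSet a }.

Definition Idem : set (QB S S) := is_idem.
End Systems.

(** * Fusion systems

    A map [P -> Q] between subgroups of [S] is encoded by its extension by [1]
    to [S], so that equality of maps is equality in [{ffun S -> S}]; a fusion
    system is given by its Hom-sets. *)

Definition homsys (S : finGroupType) :=
  {group S} -> {group S} -> {set {ffun S -> S}}.

Section Fusion.
Variable S : finGroupType.

Definition restr (P : {set S}) (f : S -> S) : {ffun S -> S} :=
  [ffun x => if x \in P then f x else 1].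

(** The inverse [f(P) -> P] of an injective map [f] on [P]. *)
Definition inv_map (P : {set S}) (f : S -> S) : {ffun S -> S} :=
  [ffun y => if [pick x in P | f x == y] is Some x then x else 1].

Definition InjHom (P Q : {set S}) : {set {ffun S -> S}} :=
  [set f : {ffun S -> S} | [&& f == restr P f, morphic P f, dinjectiveb f P
                             & f @: P \subset Q]].

(** Note that [x ^ s^-1 = s x s^-1]. *)
Definition conj_map (P : {set S}) (s : S) : {ffun S -> S} :=
  restr P (fun x => x ^ s^-1).

Definition HomS (P Q : {set S}) : {set {ffun S -> S}} :=
  [set conj_map P s | s : S & P :^ s^-1 \subset Q].

(** Identities are morphisms by [fus_inner]. *)
Record is_fusion (F : homsys S) : Prop := IsFusion {
  fus_comp : forall (P Q R : {group S}) f g, f \in F P Q -> g \in F Q R ->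
    restr P (g \o f) \in F P R;
  fus_inner : forall P Q : {group S}, HomS P Q \subset F P Q;
  fus_inj : forall P Q : {group S}, F P Q \subset InjHom P Q;
  fus_iso : forall (P Q R : {group S}) (f : {ffun S -> S}), f \in F P Q ->
    f @: P = R -> f \in F P R /\ inv_map P f \in F R P }.

Definition Fus : set (homsys S) := is_fusion.

Definition full : {group S} := [set: S]%G.

(** [{Delta(f(P), f, P) | f \in Hom_F(P, S)}] *)
Definition SysF (F : homsys S) : {set {group S * S}} :=
  [set L : {group S * S} | [exists P : {group S}, [exists f in F P full,
     (L : {set S * S}) == Delta (f : {ffun S -> S}) P]]].

Section Omega.
Variable F : homsys S.

(** The class of [S \times S / L], for twisted diagonal [L]. *)
Definition coset_cls (L : {group S * S}) : QB S S :=
  if pselect (twisted L) is left twL then cls (coset_biset twL) else 0%R.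

Definition in_BF (a : QB S S) : Prop :=
  exists c : {group S * S} -> rat, a = (\sum_(L in SysF F) c L *: coset_cls L)%R.

Definition F_isom (P Q : {group S}) : bool :=
  [exists f in F P Q, exists g in F Q P,
    (restr P (g \o f) == restr P id) && (restr Q (f \o g) == restr Q id)].

Definition Ftilde : {set {group S}} :=
  transversal (equivalence_partition F_isom [set: {group S}]) [set: {group S}].

Definition inn_class (P : {group S}) (f : {ffun S -> S}) : {set {ffun S -> S}} :=
  [set restr P (fun x => f x ^ s^-1) | s : S].

(** [Inn(S) \ Hom_F(P, S)] *)
Definition HomBar (P : {group S}) : finType :=
  {c : {set {ffun S -> S}} | c \in [set inn_class P f | f in F P full]}.

Definition hb_rep (P : {group S}) (c : HomBar P) : {ffun S -> S} :=
  odflt [ffun => 1] [pick f in val c].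

Definition QHomBar (P : {group S}) := {ffun HomBar P -> rat^o}.
Definition hb_basis (P : {group S}) (c : HomBar P) : QHomBar P :=
  [ffun d => (d == c)%:R%R].

(** The endomorphism [[psi] |-> \sum_[phi] m phi psi [phi]]. *)
Definition hb_endo (P : {group S}) (m : {ffun S -> S} -> {ffun S -> S} -> rat)
    (u : QHomBar P) : QHomBar P :=
  (\sum_(psi : HomBar P) u psi *:
     \sum_(phi : HomBar P) m (hb_rep phi) (hb_rep psi) *: hb_basis phi)%R.

Definition sigma (P : {group S}) (a : QB S S) : QHomBar P -> QHomBar P :=
  hb_endo (fun phi psi : {ffun S -> S} =>
    Phi (Delta (phi \o inv_map P psi) (psi @: P)) a / #|'C(phi @: P)|%:R)%R.

Definition eps (P : {group S}) : QHomBar P -> QHomBar P :=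
  hb_endo (fun phi _ : {ffun S -> S} =>
    #|S|%:R / (#|'C(phi @: P)|%:R * #|F P full|%:R))%R.

(** The preimage of [(eps_P)_P] under the isomorphism given by the [sigma P],
    for [P] in the transversal [Ftilde].  The [Out_F(P)]-equivariance of
    [sigma P a] and [eps P] plays no role in this equation. *)
Definition omega : QB S S :=
  xget 0%R (fun a : QB S S =>
    in_BF a /\ forall P, P \in Ftilde -> sigma a =1 @eps P).

End Omega.
End Fusion.

Arguments Fus : clear implicits.
Arguments Sys : clear implicits.
Arguments Idem : clear implicits.

(* Main.v *)
From HB Require Import structures.
Require Import Defs.
From mathcomp Require Import boolp classical_sets functions generic_quotient.
From mathcomp Require Import all_boot all_order all_algebra all_fingroup all_solvable.

Set Implicit Arguments.
Unset Strict Implicit.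
Unset Printing Implicit Defensive.

Import Order.TTheory GRing.Theory Num.Theory.
Local Open Scope group_scope.
Local Open Scope quotient_scope.
Local Notation ract := Defs.ract.
Local Notation qrepr := generic_quotient.repr.

(** Write [graph f g] for the set of the pairs [(f v, g v)], where [f] and [g] are
    arbitrary functions on a finite type [V], and [m f g] for the mark
    [Phi (graph f g) a].  Elements of the Burnside algebra are determined by
    their marks, and counting fixed points of [X \times_H Y] gives
      [m_{ab} f k = #|H|^-1 \sum_h m_a f h * m_b h k],
    the sum being over all functions [h : V -> H].  Hence [a] is right Frobenius iff
    [m f k * m g k = m f g * m g k], and left Frobenius iff
    [m k f * m k g = m k g * m g f].  When [Fix a] contains the diagonal and is closed
    under subgroups, these identities make [m f g != 0] an equivalence relation
    on functions and [m] constant on each class; idempotency forces that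
    constant to be [#|S|] over the size of the class.  So [Fix a] is a system
    which determines [a].  Conversely any system defines such an equivalence
    relation, and the classes of [f] correspond to the morphisms of the
    associated fusion system out of [<<f(V)>>]. *)

(** * Bisets as sets with an action of the product group *)

Lemma inj_surj_bij (aT rT : Type) (f : aT -> rT) :
  injective f -> (forall y, exists x, f x = y) -> bijective f.
Proof.
by move=> fI /choice[g gK]; exists g => // x; apply: fI; rewrite gK.
Qed.

Section TwistedGroups.
Variables G H : finGroupType.
Implicit Type L : {group G * H}.

(** Goursat's lemma with trivial kernels: both projections are injective on [L], so [L] is the graph
    of an isomorphism between its two projections. *)
Lemma twistedP L :
    (forall z, z \in L -> z.1 = 1 -> z = 1) ->
    (forall z, z \in L -> z.2 = 1 -> z = 1) ->
  twisted L.
Proof.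
move=> L1 L2; pose V : {group H} := (@snd G H @* L)%G.
have sndL z w : z \in L -> w \in L -> z.2 = w.2 -> z = w.
  move=> zL wL e; apply: (mulIg w^-1); rewrite mulgV; apply: L2.
    by rewrite groupM ?groupV.
  by rewrite /= e mulgV.
(* First coordinate of the only element of [L] above [v]; the default 1 is reached only outside
   [V]. *)
pose a v : G := (odflt 1 [pick z in L | z.2 == v]).1.
have aE z : z \in L -> a z.2 = z.1.
  move=> zL; rewrite /a; case: pickP => [w /andP[wL /eqP e]|/(_ z)] /=.
    by rewrite (sndL w z).
  by rewrite zL eqxx.
have VP v : reflect (exists2 z, z \in L & v = z.2) (v \in V).
  by rewrite /= /V /= morphimEsub ?subsetT //; apply: imsetP.
have aM : {in V &, {morph a : v w / v * w}}.
  move=> v w /VP[z zL ->] /VP[z' zL' ->].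
  by rewrite (aE z) // (aE z') // (aE (z * z')) // groupM.
pose am := Morphism aM.
exists (am @* V)%G, V, am; split.
  apply/isomP; split=> //; apply/injmP => v w /VP[z zL ->] /VP[z' zL' ->] /=.
  rewrite /am /= !aE // => e; congr (_.2); apply: (mulIg z'^-1); rewrite mulgV.
  by apply: L1; [rewrite groupM ?groupV|rewrite /= e mulgV].
apply/setP => z; apply/idP/imsetP => [zL|[v /VP[w wL ->] ->]].
  by exists z.2; [apply/VP; exists z|rewrite /= aE //; case: (z)].
by rewrite /= aE //; case: (w) wL.
Qed.
End TwistedGroups.

Section Bisets.
Variables G H : finGroupType.
Implicit Types (X : biset G H) (L M : {group G * H}).

Definition bact X (z : G * H) (x : X) : X := ract X (lact X z.1 x) z.2^-1.

Lemma bact1 X (x : X) : bact 1 x = x.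
Proof. by rewrite /bact invg1 lact1 ract1. Qed.

Lemma bactM X z w (x : X) : bact (z * w) x = bact z (bact w x).
Proof. by rewrite /bact invMg lactM ractM !lractA. Qed.

Lemma bact_eq X z (x : X) : (bact z x == x) = (lact X z.1 x == ract X x z.2).
Proof.
apply/eqP/eqP => [{2}<-|e]; first by rewrite /bact -ractM mulVg ract1.
by rewrite /bact e -ractM mulgV ract1.
Qed.

Lemma bact_lact X g (x : X) : bact (g, 1) x = lact X g x.
Proof. by rewrite /bact invg1 ract1. Qed.

Lemma bact_ract X h (x : X) : bact (1, h^-1) x = ract X x h.
Proof. by rewrite /bact invgK lact1. Qed.

Definition stab X (x : X) : {set G * H} := [set z | bact z x == x].

Lemma stab_group_set X (x : X) : group_set (stab x).
Proof.
apply/group_setP; split=> [|z w]; rewrite !inE ?bact1 // => /eqP ez /eqP ew.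
by rewrite bactM ew ez.
Qed.
Canonical stab_group X (x : X) := Group (stab_group_set x).

(** Bifreeness rules out non-trivial stabilizer elements with a trivial coordinate, which is the
    criterion of [twistedP]. *)
Lemma sub_stab_twisted X (x : X) L : L \subset stab x -> twisted L.
Proof.
move=> /subsetP Lx; apply: twistedP => -[g h] /Lx; rewrite inE bact_eq /= => /eqP e E.
  by move: e; rewrite E lact1 => /esym/ract_free ->.
by move: e; rewrite E ract1 => /lact_free ->.
Qed.

Lemma fixpoints_stab X (L : {set G * H}) (x : X) :
  (x \in fixpoints L X) = (L \subset stab x).
Proof.
rewrite inE; apply/forall_inP/subsetP => Lx z /Lx; by rewrite inE.
Qed.

Section Sub.
Variables (X : biset G H) (A : {set X}).
Hypothesis stA : forall z x, x \in A -> bact z x \in A.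

Lemma sub_lact_proof g (x : {x | x \in A}) : lact X g (val x) \in A.
Proof. by rewrite -bact_lact; apply/stA/valP. Qed.
Lemma sub_ract_proof (x : {x | x \in A}) h : ract X (val x) h \in A.
Proof. by rewrite -bact_ract; apply/stA/valP. Qed.

Lemma sub_biset_on : biset_on G H {x | x \in A}.
Proof.
exists (fun g x => exist _ (lact X g (val x)) (sub_lact_proof g x))
       (fun x h => exist _ (ract X (val x) h) (sub_ract_proof x h)).
- by move=> x; apply: val_inj; rewrite /= lact1.
- by move=> g g' x; apply: val_inj; rewrite /= lactM.
- by move=> x; apply: val_inj; rewrite /= ract1.
- by move=> x h h'; apply: val_inj; rewrite /= ractM.
- by move=> g x h; apply: val_inj; rewrite /= lractA.
- by move=> g x /(congr1 val) /lact_free.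
- by move=> x h /(congr1 val) /ract_free.
Defined.

Definition sub_biset : biset G H := Biset sub_biset_on.
End Sub.

Definition borbit X (x : X) : {set X} := [set bact z x | z : G * H].

Lemma borbitC X (x : X) z y : y \in ~: borbit x -> bact z y \in ~: borbit x.
Proof.
rewrite !inE; apply: contra => /imsetP[w _ e]; apply/imsetP.
by exists (z^-1 * w) => //; rewrite bactM -e -bactM mulVg bact1.
Qed.

Lemma coset_bact L (twL : twisted L) z (A : coset_biset twL) :
  val (bact z A) = z *: val A.
Proof.
rewrite /bact /= -lcosetM; congr (_ *: _).
by case: z => g h; rewrite /= invgK; congr pair; rewrite ?mulg1 ?mul1g.
Qed.

(** Orbit-stabilizer: the cosets of [stab x] parametrize the orbit of [x], and the complement of the
    orbit maps in by inclusion. *)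
Lemma biso_orbit X (x : X) (twx : twisted (stab x)) :
  biso (sum_biset (coset_biset (L := stab_group x) twx) (sub_biset (@borbitC X x))) X.
Proof.
pose f (y : sum_biset (coset_biset (L := stab_group x) twx) (sub_biset (@borbitC X x))) : X :=
  match y with inl A => bact (repr (val A)) x | inr y => val y end.
(* The image does not depend on which representative of the coset acts on [x]. *)
have fl (A : coset_car (stab_group x)) w : val A = w *: stab x -> f (inl A) = bact w x.
  move=> Aw; rewrite /f; have : repr (val A) \in val A.
    by rewrite Aw (mem_repr w) // lcoset_refl.
  rewrite {2}Aw mem_lcoset inE => /eqP e.
  by rewrite -[X in bact X x](mulKVg w) bactM e.
have coE w : w *: stab x \in lcosets (stab x) setT by apply/lcosetsP; exists w.
have fb z y : f (bact z y) = bact z (f y).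
  case: y => [A|y]; last by [].
  have /lcosetsP[w _ Aw] := valP A.
  rewrite (fl _ _ Aw) -bactM; apply: fl.
  rewrite lcosetM -Aw; exact: (@coset_bact _ twx z A).
exists f; split=> [|g y|y h].
- apply: inj_surj_bij => [[A|y] [B|y']|y].
  + have /lcosetsP[w _ Aw] := valP A; have /lcosetsP[w' _ Bw] := valP B.
    rewrite (fl _ _ Aw) (fl _ _ Bw) => e; congr inl; apply: val_inj.
    rewrite Aw Bw; apply/esym/lcoset_eqP; rewrite mem_lcoset inE.
    by rewrite bactM -e -bactM mulVg bact1.
  + move=> e; have := valP y'; rewrite -[val y']e inE.
    by case/negP; apply: imset_f.
  + move=> e; have := valP y; rewrite [val y]e inE.
    by case/negP; apply: imset_f.
  + by move=> /= e; congr inr; apply: val_inj.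
- case: (boolP (y \in borbit x)) => [/imsetP[w _ ->]|].
    by exists (inl (exist _ (w *: stab x) (coE w))); apply: fl.
  by rewrite -in_setC => yA; exists (inr (exist _ y yA)).
- by have := fb (g, 1) y; rewrite !bact_lact.
- by have := fb (1, h^-1) y; rewrite !bact_ract.
Qed.

Local Open Scope ring_scope.

Lemma phi_additive (L : {set G * H}) :
  additive_inv (fun X : biset G H => (#|fixpoints L X|%:R : rat^o)).
Proof.
split=> [X Y XY|X Y Z XYZ]; rewrite -!(@Phi_cls G H L).
  by rewrite (proj1 (@cls_additive G H) _ _ XY).
rewrite (proj1 (@cls_additive G H) _ _ XYZ) !Phi_cls -natrD; congr (_%:R).
by rewrite -!sum1dep_card big_sumType /=; congr addn; apply: eq_bigl => y; rewrite !inE.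
Qed.

Lemma Phi_linear (L : {set G * H}) : linear (Phi L : QB G H -> rat^o).
Proof. move=> c x y; exact: (qb_lift_linear (phi_additive L)). Qed.
HB.instance Definition _ (L : {set G * H}) :=
  GRing.isLinear.Build rat (QB G H) rat^o *:%R (Phi L : QB G H -> rat^o) (@Phi_linear L).

End Bisets.

(** * Elements of the Burnside algebra are determined by their marks *)

Section Marks.
Variables G H : finGroupType.
Implicit Types (X : biset G H) (L M : {group G * H}) (a b : QB G H).
Local Open Scope ring_scope.

Lemma PhiE (L : {set G * H}) a :
  Phi L a = \sum_(q <- qrepr a) q.1 * #|fixpoints L q.2|%:R.
Proof. by []. Qed.

Lemma qb_ind (P : QB G H -> Prop) :
    P 0 -> (forall c x y, P x -> P y -> P (c *: x + y)) -> (forall X, P (cls X)) ->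
  forall a, P a.
Proof.
move=> P0 PD PX a; have [u ->] := qb_repr a.
elim: u => [|[c X] u IH]; first exact: P0.
have -> : \pi_(QB G H) ((c, X) :: u) = c *: cls X + \pi_(QB G H) u :> QB G H.
  have -> : cls X = \pi_(QB G H) [:: (1, X)].
    by apply/qb_eqP/FEiso/biso_sym/ord_biset_iso.
  by rewrite [c *: _]qb_scaleE [_ + _]qb_addE /= mulr1.
exact: PD.
Qed.

(** An empty [X] is isomorphic to [X + X], so its class equals its own double. *)
Lemma cls_empty X : #|X| = 0%N -> cls X = 0.
Proof.
move=> X0; have noX (x : X) : False by have := card0_eq X0 x.
have : cls X = cls X + cls X.
  apply: (proj2 (@cls_additive G H)).
  exists (inl : X -> sum_biset X X); split=> //.
  by exists (fun z : X + X => match z with inl x => x | inr x => x end) => [//|[]x]; case: (noX x).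
by move=> e; apply: (addrI (cls X)); rewrite -e addr0.
Qed.

(** Version of [coset_cls] for two groups; the value 0 off the twisted subgroups lets sums run over
    all subgroups. *)
Definition coset_class L : QB G H :=
  if pselect (twisted L) is left twL then cls (coset_biset twL) else 0.

Lemma coset_classE L (twL : twisted L) : coset_class L = cls (coset_biset twL).
Proof.
rewrite /coset_class; case: pselect => // tw'.
by rewrite (Prop_irrelevance tw' twL).
Qed.

Lemma cls_orbit X (x : X) :
  cls X = coset_class (stab_group x) + cls (sub_biset (@borbitC _ _ X x)).
Proof.
have tw : twisted (stab x) by apply: (sub_stab_twisted (x := x) (L := stab_group x)).
rewrite (coset_classE (L := stab_group x) tw); apply: (proj2 (@cls_additive G H)).
exact/biso_sym/biso_orbit.
Qed.

(** Induction on [#|X|], splitting off one orbit at a time. *)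
Lemma qb_span a : exists c : {group G * H} -> rat, a = \sum_L c L *: coset_class L.
Proof.
elim/qb_ind: a => [|r x y [cx ->] [cy ->]|X].
- by exists (fun=> 0); rewrite big1 // => L _; rewrite scale0r.
- exists (fun L => r * cx L + cy L); rewrite scaler_sumr -big_split; apply: eq_bigr => L _ /=.
  by rewrite scalerA scalerDl.
have [n] := ubnP #|X|; elim: n X => // n IH X /ltnSE leX.
have [X0|] := eqVneq #|X| 0%N.
  exists (fun=> 0); rewrite big1 => [|L _]; last by rewrite scale0r.
  exact: cls_empty.
rewrite -lt0n => /card_gt0P[x _].
have [|c cE] := IH (sub_biset (@borbitC _ _ X x)).
  apply: leq_trans leX; rewrite card_sig.
  rewrite -[X in (X < _)%N](_ : #|~: borbit x| = _); last first.
    by apply: eq_card => y; rewrite inE.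
  rewrite -cardsT; apply: proper_card; rewrite properE subsetT.
  apply/subsetPn; exists x; rewrite ?inE ?negbK //.
  by apply/imsetP; exists 1%g; rewrite ?bact1.
exists (fun L => (L == stab_group x)%:R + c L).
rewrite (cls_orbit x) cE; under [RHS]eq_bigr => L _ do rewrite scalerDl.
rewrite big_split /=; congr (_ + _).
rewrite (bigD1 (stab_group x)) //= eqxx scale1r big1 ?addr0 // => L /negPf ->.
by rewrite scale0r.
Qed.

Lemma coset_stab L (twL : twisted L) (x : coset_biset twL) w :
  val x = (w *: L)%g -> stab x = (L :^ w^-1)%g.
Proof.
move=> xw; apply/setP => z; rewrite inE mem_conjg invgK.
rewrite -(inj_eq val_inj) coset_bact xw -lcosetM (sameP eqP lcoset_eqP).
by rewrite mem_lcoset conjgE.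
Qed.

Lemma coset_ptP L w : (w *: L \in lcosets L [set: G * H])%g.
Proof. by apply/lcosetsP; exists w. Qed.
Definition coset_pt L (twL : twisted L) w : coset_biset twL :=
  exist _ (w *: (L : {set G * H}))%g (coset_ptP L w).

Lemma stab_coset_pt L (twL : twisted L) w : stab (coset_pt twL w) = (L :^ w^-1)%g.
Proof. exact: coset_stab. Qed.

(** The coset biset of [L] is transitive and has a point with stabilizer [L :^ w]; splitting off its
    orbit leaves the empty biset. *)
Lemma coset_class_conj L w : coset_class (L :^ w)%G = coset_class L.
Proof.
case: (pselect (twisted L)) => [twL|ntw]; last first.
  rewrite /coset_class; case: pselect => [tw|_]; last by case: pselect.
  (* If [L :^ w] is twisted, then so is [L], being the stabilizer of a point of that coset biset. *)
  case: ntw; have := stab_coset_pt tw w.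
  rewrite /= -conjsgM mulgV conjsg1 => e.
  by apply: (sub_stab_twisted (x := coset_pt tw w)); rewrite e.
pose x := coset_pt twL w^-1%g; have sx : stab_group x = (L :^ w)%G.
  by apply: val_inj; rewrite /= stab_coset_pt invgK.
rewrite -sx (coset_classE twL) (cls_orbit x) [X in _ = _ + X]cls_empty ?addr0 //.
apply: eq_card0 => -[y yx]; have := yx; rewrite inE => /negP[].
have /lcosetsP[u _ yu] := valP y; apply/imsetP; exists (u * w)%g => //.
by apply: val_inj; rewrite coset_bact yu -lcosetM mulgK.
Qed.

Lemma Phi_neq0 (L : {set G * H}) a :
  Phi L a != 0 -> exists X, exists x : X, L \subset stab x.
Proof.
rewrite PhiE => Ln0; have [[X [x xL]]|no] := pselect (exists X, exists x : X, L \subset stab x).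
  by exists X, x.
case/eqP: Ln0; rewrite big1_seq // => -[c X] _ /=.
rewrite [fixpoints L X](_ : _ = finset.set0) ?cards0 ?mulr0 //; apply/setP => x; rewrite in_set0.
by rewrite fixpoints_stab; apply: contra_notF no => xL; exists X, x.
Qed.

Lemma Phi_twisted L a : Phi L a != 0 -> twisted L.
Proof. by case/Phi_neq0=> X [x /sub_stab_twisted]. Qed.

(** Being fixed by a set or by the subgroup it generates is the same, so marks can be taken at
    arbitrary graphs. *)
Lemma Phi_gen (L : {set G * H}) a : Phi <<L>> a = Phi L a.
Proof.
rewrite !PhiE; apply: eq_bigr => q _; congr (_ * _%:R); apply: eq_card => x.
by rewrite !fixpoints_stab gen_subG.
Qed.

Lemma bact_inj X w : injective (@bact G H X w).
Proof. by apply: (can_inj (g := bact w^-1%g)) => x; rewrite -bactM mulVg bact1. Qed.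

Lemma stab_bact X w (x : X) : stab (bact w x) = (stab x :^ w^-1)%g.
Proof.
apply/setP => z; rewrite mem_conjg invgK !inE -bactM.
by rewrite -(inj_eq (bact_inj (w := w^-1%g))) -!bactM mulVg bact1 conjgE.
Qed.

Lemma Phi_conj (L : {set G * H}) w a : Phi (L :^ w)%g a = Phi L a.
Proof.
rewrite !PhiE; apply: eq_bigr => q _; congr (_ * _%:R).
rewrite -(card_preimset (fixpoints L q.2) (@bact_inj q.2 w)); apply: eq_card => x.
by rewrite [RHS]inE !fixpoints_stab stab_bact sub_conjg.
Qed.

(** Triangularity of the table of marks: all point stabilizers in the coset biset of [M] are
    conjugates of [M]. *)
Lemma Phi_coset L (M : {group G * H}) : Phi L (coset_class M) != 0 ->
  exists z, L \subset (M :^ z)%g.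
Proof.
case: (pselect (twisted M)) => [twM|ntw]; last first.
  by rewrite /coset_class; case: pselect => // _; rewrite raddf0 eqxx.
rewrite (coset_classE twM) Phi_cls pnatr_eq0 -lt0n => /card_gt0P[x].
rewrite fixpoints_stab; have /lcosetsP[w _ xw] := valP x.
by rewrite (coset_stab xw); exists (w^-1)%g.
Qed.

Lemma Phi_coset_ge0 L (M : {group G * H}) : 0 <= Phi L (coset_class M).
Proof.
rewrite /coset_class; case: pselect => [tw|_]; first by rewrite Phi_cls ler0n.
by rewrite raddf0.
Qed.

Lemma Phi_coset_gt0 L : twisted L -> 0 < Phi L (coset_class L).
Proof.
move=> tw; rewrite (coset_classE tw) Phi_cls ltr0n; apply/card_gt0P.
exists (coset_pt tw 1%g); rewrite fixpoints_stab stab_coset_pt.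
by rewrite invg1 conjsg1.
Qed.


(** After averaging the coefficients over conjugates, a subgroup [L] of maximal
    order with nonzero coefficient would have a nonzero mark. *)
Lemma Phi_inj a b :
  (forall L, twisted L -> Phi L a = Phi L b) -> a = b.
Proof.
move=> ab; apply/eqP; rewrite -subr_eq0; apply/eqP.
have : forall L, Phi L (a - b) = 0.
  move=> L; apply/eqP; apply: contraT => nz.
  by rewrite -(negbTE nz) raddfB /= (ab L (Phi_twisted nz)) subrr eqxx.
move: (a - b) => {ab}{}a a0; have [c ac] := qb_span a.
pose N : rat := #|[set: G * H]|%:R.
have Nn0 : N != 0 by rewrite pnatr_eq0 -lt0n cardG_gt0.
pose d L := N^-1 * \sum_w c (L :^ w)%G.
have ad : a = \sum_L d L *: coset_class L.
  transitivity (N^-1 *: \sum_(w : G * H) \sum_L c (L :^ w)%G *: coset_class L).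
    rewrite (eq_bigr (fun=> a)) ?sumr_const => [|w _].
      by rewrite -cardsT -scaler_nat scalerA mulVf ?scale1r.
    rewrite ac [RHS](reindex_inj (h := fun L => (L :^ w)%G)) /=.
      by apply: eq_bigr => L _; rewrite coset_class_conj.
    by move=> L M /(congr1 val) /= /conjsg_inj e; apply: val_inj.
  rewrite exchange_big scaler_sumr; apply: eq_bigr => L _.
  by rewrite -scaler_suml scalerA.
have dJ L w : d (L :^ w)%G = d L.
  congr (_ * _); rewrite [RHS](reindex_inj (mulgI w)); apply: eq_bigr => u _.
  by congr c; apply: val_inj; rewrite /= conjsgM.
rewrite ad big1 // => L _.
(* Downward induction on the order of [L]. *)
have [n] := ubnP (#|[set: G * H]| - #|L|); elim: n L => // n IH L /ltnSE leL.
have [tw|ntw] := pselect (twisted L); last first.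
  by rewrite /coset_class; case: pselect => // _; rewrite scaler0.
suff -> : d L = 0 by rewrite scale0r.
have := a0 L; rewrite ad linear_sum /= => /eqP.
(* Larger [M] have coefficient zero by induction, and an [M] of order [#|L|] with non-zero mark at
   [L] is conjugate to [L], so that [d M = d L]. The mark at [L] is therefore [d L * K], with [K]
   positive. *)
pose K := \sum_(M : {group G * H} | #|M| == #|L|) Phi L (coset_class M).
rewrite (_ : \sum_M _ = d L * K); last first.
  rewrite mulr_sumr big_mkcond [RHS]big_mkcond /=; apply: eq_bigr => M _; rewrite linearZ /=.
  have [->|nz] := eqVneq (Phi L (coset_class M)) 0.
    by rewrite mulr0 scaler0; case: ifP.
  have [w Lw] := Phi_coset nz; case: eqP => [e|/eqP ne].
    suff -> : L = (M :^ w)%G by rewrite dJ.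
    by apply/val_inj/eqP; rewrite eqEcard Lw cardJg e leqnn.
  have /(IH M) : (#|[set: G * H]| - #|M| < n)%N.
    have ltLM : (#|L| < #|M|)%N by rewrite ltn_neqAle eq_sym ne -(cardJg M w) subset_leq_card.
    apply: leq_trans leL; rewrite ltn_sub2l // (leq_trans ltLM) // subset_leq_card ?subsetT //.
  by move=> /(congr1 (Phi L)); rewrite linearZ raddf0.
rewrite mulf_eq0 => /orP[/eqP //|]; rewrite gt_eqF //.
rewrite /K (bigD1 L) //=; apply: ltr_wpDr; last exact: Phi_coset_gt0.
by apply: sumr_ge0 => M _; apply: Phi_coset_ge0.
Qed.

End Marks.

(** * Marks of products *)

Section MarkExists.
Variables G H : finGroupType.
Implicit Types L M : {group G * H}.
Local Open Scope ring_scope.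

(** The triangular system is solved from the large subgroups down: stage [n] adds classes of
    subgroups of order [N - n], which does not affect marks at larger subgroups. *)
Lemma mark_exists (A : {set {group G * H}}) (t : {group G * H} -> rat) :
    (forall L, L \in A -> twisted L) ->
    (forall L w, L \in A -> (L :^ w)%G \in A) ->
    (forall L w, L \in A -> t (L :^ w)%G = t L) ->
  exists c : {group G * H} -> rat,
    forall L, L \in A -> Phi L (\sum_(M in A) c M *: coset_class M) = t L.
Proof.
move=> twA cA tJ; pose N := #|[set: G * H]|.
have leN L : (#|L| <= N)%N by rewrite subset_leq_card ?subsetT.
suff /(_ N.+1)[c cP] : forall n, exists c : {group G * H} -> rat, forall L, L \in A ->
    (N - #|L| < n)%N -> Phi L (\sum_(M in A) c M *: coset_class M) = t L.
  by exists c => L LA; apply: cP => //; rewrite ltnS leq_subr.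
elim=> [|n [c cP]]; first by exists (fun=> 0).
pose a := \sum_(M in A) c M *: coset_class M.
pose K L := \sum_(M in A | #|M| == #|L|) Phi L (coset_class M).
have Kgt0 L : L \in A -> 0 < K L.
  move=> LA; rewrite /K (bigD1 L) /= ?LA ?eqxx //; apply: ltr_wpDr.
    by apply: sumr_ge0 => M _; apply: Phi_coset_ge0.
  exact/Phi_coset_gt0/twA.
have KJ L w : K (L :^ w)%G = K L.
  by apply: eq_big => [M|M _]; rewrite ?cardJg // Phi_conj.
(* The correction is spread evenly over conjugates: all the conjugates of [L] together change the
   mark at [L] by [d L * K L]. *)
pose d L := if (N - #|L|)%N == n then (t L - Phi L a) / K L else 0.
have dJ L w : L \in A -> d (L :^ w)%G = d L.
  by move=> LA; rewrite /d cardJg KJ Phi_conj tJ.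
exists (fun L => c L + d L) => L LA; rewrite ltnS => leL.
under eq_bigr => M _ do rewrite scalerDl.
rewrite big_split /= raddfD /= -/a [X in _ + X]raddf_sum /=.
have PhiLM M : Phi L (coset_class M) != 0 ->
    (#|L| < #|M|)%N \/ exists w, L = (M :^ w)%G.
  case/Phi_coset=> w Lw; have := subset_leq_card Lw.
  rewrite leq_eqVlt cardJg => /orP[/eqP e|]; [right|by left].
  by exists w; apply/val_inj/eqP; rewrite eqEcard Lw cardJg e leqnn.
have [e|ne] := eqVneq (N - #|L|)%N n; last first.
  rewrite big1 ?addr0 => [|M MA]; first by apply: cP => //; rewrite ltn_neqAle ne.
  rewrite linearZ /= /d; case: eqP => [eM|_]; last exact: mul0r.
  have [->|/PhiLM[ltLM|[w Lw]]] := eqVneq (Phi L (coset_class M)) 0; first exact: mulr0.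
    have : (N - #|M| < N - #|L|)%N by rewrite ltn_sub2l // (leq_trans ltLM).
    by rewrite eM ltnNge leL.
  by case/eqP: ne; rewrite Lw cardJg.
rewrite (_ : \sum_(M in A) _ = d L * K L).
  by rewrite /d e eqxx divfK ?gt_eqF ?Kgt0 // addrC subrK.
rewrite mulr_sumr big_mkcondr; apply: eq_bigr => M MA; rewrite linearZ /=.
have [->|/PhiLM[ltLM|[w ->]]] := eqVneq (Phi L (coset_class M)) 0.
- by rewrite mulr0 scaler0; case: ifP.
- rewrite gtn_eqF // /d; case: eqP => [eM|_]; last exact: mul0r.
  have : (N - #|M| < N - #|L|)%N by rewrite ltn_sub2l // (leq_trans ltLM).
  by rewrite eM e ltnn.
- by rewrite cardJg eqxx dJ.
Qed.
End MarkExists.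

(** * Marks at graphs of tensor and cross products *)

Section Graph.
Variables (V : finType).

Definition graph (G H : finGroupType) (f : V -> G) (g : V -> H) : {set G * H} :=
  [set (f v, g v) | v : V].

Lemma fixpoints_graph (G H : finGroupType) (f : V -> G) (g : V -> H) (X : biset G H) x :
  (x \in fixpoints (graph f g) X) = [forall v, lact X (f v) x == ract X x (g v)].
Proof.
rewrite fixpoints_stab; apply/subsetP/forallP => [fx v|fx z /imsetP[v _ ->]].
  have : (f v, g v) \in stab x by apply: fx; apply/imsetP; exists v.
  by rewrite inE bact_eq.
by rewrite inE bact_eq; apply: fx.
Qed.

Section Tensor.
Variables (G H K : finGroupType).

(** If [(x, y)] represents a fixed point, then [f v x = x h] and [h y = y k v] for a
    unique [h = h v], by freeness. *)
Lemma card_fix_tensor (X : biset G H) (Y : biset H K) (f : V -> G) (k : V -> K) :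
  (#|H| * #|fixpoints (graph f k) (tensor_biset X Y)| =
  \sum_(h : {ffun V -> H}) #|fixpoints (graph f h) X| * #|fixpoints (graph h k) Y|)%N.
Proof.
pose hz z h := (ract X z.1 h^-1, lact Y h z.2).
have rI (x : X) : injective (ract X x).
  move=> h h' e; apply/eqP; rewrite eq_mulgV1; apply/eqP.
  by apply: (@ract_free _ _ _ X x); rewrite ractM e -ractM mulgV ract1.
(* By freeness each fibre of [tensor_pi] has [#|H|] elements. *)
have cardT (B : {set tensor_biset X Y}) :
    #|[set z : X * Y | (tensor_pi z : tensor_biset X Y) \in B]| = (#|H| * #|B|)%N.
  rewrite -[LHS]sum1_card [LHS](partition_big (@tensor_pi _ _ _ X Y : X * Y -> tensor_biset X Y) (fun A => A \in B)); last first.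
    by move=> z; rewrite inE.
  rewrite mulnC -sum_nat_const; apply: eq_bigr => A AF.
  have [z Az] := tensor_piP A; rewrite sum1dep_card -cardsT.
  rewrite -(card_imset _ (f := hz z)); last first.
    by move=> h h' [/rI/invg_inj].
  apply: eq_card => w; rewrite !inE; apply/andP/imsetP => [[_ /eqP]|[h _ ->]].
    by rewrite Az => /esym/tensor_pi_eq[h ->]; exists h.
  suff -> : tensor_pi (hz z h) = A by rewrite AF eqxx.
  by rewrite Az; apply/esym/tensor_pi_eq; exists h.
rewrite -cardT.
pose P h (z : X * Y) := (z.1 \in fixpoints (graph f h) X) && (z.2 \in fixpoints (graph h k) Y).
have PP h z : reflect (forall v, ract X z.1 (h v) = lact X (f v) z.1 /\
    lact Y (h v) z.2 = ract Y z.2 (k v)) (P h z).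
  rewrite /P !fixpoints_graph; apply: (iffP andP) => [[/forallP a /forallP b] v|ab].
    by rewrite (eqP (a v)) (eqP (b v)).
  by split; apply/forallP => v; have [a b] := ab v; rewrite ?a ?b.
(* Double count the pairs [(h, z)] with [P h z]: a given [z] has one such [h] if its class is fixed,
   and none otherwise. *)
transitivity (\sum_(h : {ffun V -> H}) \sum_(z | P h z) 1)%N; last first.
  apply: eq_bigr => h _; rewrite sum1dep_card -cardsX; apply: eq_card => z.
  by rewrite !inE.
rewrite (exchange_big_dep predT) //= -sum1_card big_mkcond /=; apply: eq_bigr => z _.
rewrite inE; case: ifP => zF; last first.
  rewrite big_pred0 // => h; apply/negP => /PP hz'; case/negP: zF.
  rewrite (@fixpoints_graph _ _ f k (tensor_biset X Y) (tensor_pi z)).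
  apply/forallP => v; apply/eqP.
  rewrite [LHS]tensor_lactE [RHS]tensor_ractE; have [h1 h2] := hz' v.
  by apply/tensor_pi_eq; exists (h v); rewrite /= h2 -h1 -ractM mulgV ract1.
have /choice[h hP] : forall v, exists h, ract X z.1 h = lact X (f v) z.1 /\
    lact Y h z.2 = ract Y z.2 (k v).
  move=> v.
  move: zF; rewrite (@fixpoints_graph _ _ f k (tensor_biset X Y) (tensor_pi z)) => /forallP/(_ v)/eqP.
  rewrite [LHS]tensor_lactE [RHS]tensor_ractE => /tensor_pi_eq[h /= [h1 h2]].
  by exists h; rewrite h2; split=> //; rewrite {1}h1 -ractM mulVg ract1.
rewrite (big_pred1 (finfun h)) // => h'; apply/PP/eqP => [h'P|-> v]; last by rewrite ffunE.
by apply/ffunP => v; rewrite ffunE; apply: (@rI z.1); rewrite (proj1 (h'P v)) (proj1 (hP v)).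
Qed.

Local Open Scope ring_scope.

Lemma Phi_lift2 (G1 H1 G2 H2 : finGroupType) (L : {set G * H})
    (F : biset G1 H1 -> biset G2 H2 -> biset G H) a b :
  Phi L (qb_lift2 (fun X Y => cls (F X Y)) a b) =
  \sum_(q <- qrepr a) \sum_(r <- qrepr b) q.1 * r.1 * #|fixpoints L (F q.2 r.2)|%:R.
Proof.
rewrite /qb_lift2 /qb_lift raddf_sum; apply: eq_bigr => q _ /=.
rewrite linearZ (raddf_sum (Phi L)) /= scaler_sumr.
by apply: eq_bigr => r _; rewrite linearZ /= Phi_cls scalerA.
Qed.
End Tensor.

Local Open Scope ring_scope.

Lemma Phi_mul (G H K : finGroupType) (f : V -> G) (k : V -> K) (a : QB G H) (b : QB H K) :
  Phi (graph f k) (qb_mul a b) =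
  #|H|%:R^-1 * \sum_(h : {ffun V -> H}) Phi (graph f h) a * Phi (graph h k) b.
Proof.
have H0 : #|H|%:R != 0 :> rat by rewrite pnatr_eq0 -lt0n -cardsT cardG_gt0.
apply: (mulfI H0); rewrite mulVKf // Phi_lift2 mulr_sumr.
under [RHS]eq_bigr => h _ do rewrite !PhiE mulr_suml.
rewrite exchange_big /=; apply: eq_bigr => q _.
under [RHS]eq_bigr => h _ do rewrite mulr_sumr.
rewrite exchange_big /= mulr_sumr; apply: eq_bigr => r _.
rewrite mulrCA -natrM card_fix_tensor natr_sum mulr_sumr; apply: eq_bigr => h _.
by rewrite natrM mulrACA.
Qed.

Variable S : finGroupType.
Implicit Types (a b : QB S S).

Lemma Phi_crossl (f g : V -> S) (h : V -> S) a b :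
  Phi (graph (fun v => (f v, g v)) h) (qb_crossl a b) =
  Phi (graph f h) a * Phi (graph g h) b.
Proof.
rewrite Phi_lift2 !PhiE mulr_suml; apply: eq_bigr => q _; rewrite mulr_sumr.
apply: eq_bigr => r _; rewrite mulrACA -natrM -cardsX; congr (_ * _%:R).
apply: eq_card => -[x y]; rewrite in_setX !fixpoints_graph.
apply/forallP/andP => [fx|[/forallP fx /forallP fy] v].
  by split; apply/forallP => v; have /eqP[e1 e2] := fx v; apply/eqP.
by rewrite /= (eqP (fx v)) (eqP (fy v)).
Qed.

Lemma Phi_crossr (f g : V -> S) (h : V -> S) a b :
  Phi (graph h (fun v => (f v, g v))) (qb_crossr a b) =
  Phi (graph h f) a * Phi (graph h g) b.
Proof.
rewrite Phi_lift2 !PhiE mulr_suml; apply: eq_bigr => q _; rewrite mulr_sumr.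
apply: eq_bigr => r _; rewrite mulrACA -natrM -cardsX; congr (_ * _%:R).
apply: eq_card => -[x y]; rewrite in_setX !fixpoints_graph.
apply/forallP/andP => [fx|[/forallP fx /forallP fy] v].
  by split; apply/forallP => v; have /eqP[e1 e2] := fx v; apply/eqP.
by rewrite /= (eqP (fx v)) (eqP (fy v)).
Qed.

(** A point [s] of the regular biset is fixed when [f v * s = s * g v] for all [v]. *)
Lemma Phi_one (f g : V -> S) :
  Phi (graph f g) (qb_one S) = #|[set s | [forall v, f v == (g v ^ s^-1)%g]]|%:R.
Proof.
rewrite Phi_cls; congr (_%:R); apply: eq_card => s; rewrite [RHS]inE (@fixpoints_graph _ _ f g (regular_biset S) s).
by apply: eq_forallb => v /=; rewrite conjgE invgK mulgA (can2_eq (mulgK s) (mulgVK s)).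
Qed.

Lemma Phi_graphJ (f g : V -> S) s t a :
  Phi (graph (fun v => f v ^ s)%g (fun v => g v ^ t)%g) a = Phi (graph f g) a.
Proof.
rewrite -[RHS](Phi_conj _ (s, t)); congr (Phi _ a); apply/setP => z.
apply/imsetP/imsetP => [[v _ ->]|[_ /imsetP[v _ ->] ->]]; last by exists v.
by exists (f v, g v) => //; apply/imsetP; exists v.
Qed.

End Graph.

(** * Frobenius idempotents and systems *)

Section FrobeniusMarks.
Variable S : finGroupType.
Implicit Type a : QB S S.

(** Indexing a set of pairs by its own elements makes it a graph, so identities for marks at graphs
    reach every subgroup. *)
Lemma graph_set (G H : finGroupType) (L : {set G * H}) :
  graph (fun v : {z | z \in L} => (val v).1) (fun v => (val v).2) = L.
Proof.
apply/setP => z; apply/imsetP/idP => [[v _ ->]|zL].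
  by rewrite -surjective_pairing (valP v).
by exists (exist _ z zL); rewrite -?surjective_pairing.
Qed.

Lemma gen_graph_set (G H : finGroupType) (L : {group G * H}) :
  <<graph (fun v : {z | z \in L} => (val v).1) (fun v => (val v).2)>>%G = L.
Proof. by apply: val_inj; rewrite /= graph_set genGid. Qed.

Lemma sub_graph (V : finType) (G H : finGroupType) (f : V -> G) (g : V -> H) (L : {set G * H}) :
  (forall v, (f v, g v) \in L) -> graph f g \subset L.
Proof. by move=> fgL; apply/subsetP => _ /imsetP[v _ ->]. Qed.

Lemma mem_graph (V : finType) (G H : finGroupType) (f : V -> G) (g : V -> H) v :
  (f v, g v) \in graph f g.
Proof. by apply/imsetP; exists v. Qed.

Local Open Scope ring_scope.

(** Collapses the sum of [Phi_mul] when one factor is a mark of [qb_one]: the weights count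
    conjugators, and exchanging the sums leaves [#|S|] terms equal to [c]. *)
Lemma sum_conj (V : finType) (g : V -> S) (F : {ffun V -> S} -> rat) c :
    (forall s, F [ffun v => g v ^ s]%g = c) ->
  #|S|%:R^-1 * (\sum_(h : {ffun V -> S}) #|[set s | [forall v, h v == (g v ^ s)%g]]|%:R * F h) = c.
Proof.
move=> Fc; have S0 : #|S|%:R != 0 :> rat by rewrite pnatr_eq0 -lt0n -cardsT cardG_gt0.
apply: (mulfI S0); rewrite mulVKf //.
transitivity (\sum_(h : {ffun V -> S}) \sum_(s : S | [forall v, h v == (g v ^ s)%g]) F h).
  by apply: eq_bigr => h _; rewrite sumr_const mulr_natl; congr (_ *+ _); apply: eq_card => s; rewrite !inE.
rewrite (exchange_big_dep predT) //= (eq_bigr (fun=> c)); last first.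
  move=> s _; rewrite (big_pred1 [ffun v => g v ^ s]%g) // => h.
  apply/forallP/eqP => [hE|-> v]; last by rewrite ffunE.
  by apply/ffunP => v; rewrite ffunE; apply/eqP.
by rewrite sumr_const mulr_natl.
Qed.

(** In the sum of [Phi_mul], the factor [qb_one] forces [h] to be an [S]-conjugate of [g], and
    conjugating one coordinate does not change marks. *)
Lemma Phi_frobl (V : finType) (f g k : V -> S) a :
  Phi (graph (fun v => (f v, g v)) k) (qb_mul (qb_crossl a (qb_one S)) a) =
  Phi (graph f g) a * Phi (graph g k) a.
Proof.
rewrite Phi_mul -[RHS](@sum_conj V g (fun h => Phi (graph f h) a * Phi (graph h k) a)); last first.
  by move=> s; congr (_ * _); [rewrite -[RHS](Phi_graphJ _ _ 1 s)|rewrite -[RHS](Phi_graphJ _ _ s 1)];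
     congr Phi; apply: eq_imset => v; rewrite ffunE conjg1.
congr (_ * _); apply: eq_bigr => h _; rewrite Phi_crossl Phi_one mulrAC mulrC.
congr (_%:R * _); apply: eq_card => s; rewrite !inE; apply: eq_forallb => v.
by rewrite -(can2_eq (conjgKV s) (conjgK s)) eq_sym.
Qed.

Lemma Phi_frobr (V : finType) (f g k : V -> S) a :
  Phi (graph k (fun v => (f v, g v))) (qb_mul a (qb_crossr a (qb_one S))) =
  Phi (graph k g) a * Phi (graph g f) a.
Proof.
rewrite Phi_mul -[RHS](@sum_conj V g (fun h => Phi (graph k h) a * Phi (graph h f) a)); last first.
  by move=> s; congr (_ * _); [rewrite -[RHS](Phi_graphJ _ _ 1 s)|rewrite -[RHS](Phi_graphJ _ _ s 1)];
     congr Phi; apply: eq_imset => v; rewrite ffunE conjg1.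
congr (_ * _); apply: eq_bigr => h _; rewrite Phi_crossr Phi_one mulrA mulrC; congr (_%:R * _).
(* The mark of [qb_one] counts conjugators [s^-1] here, whence the reindexing by inverses. *)
rewrite -(card_preimset _ (@invg_inj S)); apply: eq_card => s; rewrite !inE.
by apply: eq_forallb => v; rewrite invgK.
Qed.

Definition right_frobenius_marks a := forall (V : finType) (f g k : V -> S),
  Phi (graph f k) a * Phi (graph g k) a = Phi (graph f g) a * Phi (graph g k) a.
Definition left_frobenius_marks a := forall (V : finType) (f g k : V -> S),
  Phi (graph k f) a * Phi (graph k g) a = Phi (graph k g) a * Phi (graph g f) a.

(** For the converse, a subgroup of [(S * S) * S] is a graph whose first coordinate splits into two
    functions, and [Phi_inj] applies. *)
Lemma right_frobeniusE a : right_frobenius a <-> right_frobenius_marks a.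
Proof.
split=> [e V f g k|e]; first by rewrite -Phi_crossl e Phi_frobl.
apply: Phi_inj => L _; rewrite -(graph_set L).
rewrite (_ : (fun v : {z | z \in L} => (val v).1) = fun v => ((val v).1.1, (val v).1.2)).
  by rewrite Phi_crossl Phi_frobl e.
by apply/funext => v; rewrite -surjective_pairing.
Qed.

Lemma left_frobeniusE a : left_frobenius a <-> left_frobenius_marks a.
Proof.
split=> [e V f g k|e]; first by rewrite -Phi_crossr e Phi_frobr.
apply: Phi_inj => L _; rewrite -(graph_set L).
rewrite (_ : (fun v : {z | z \in L} => (val v).2) = fun v => ((val v).2.1, (val v).2.2)).
  by rewrite Phi_crossr Phi_frobr e.
by apply/funext => v; rewrite -surjective_pairing.
Qed.

Lemma idem_mulE a : qb_mul a a = a <-> forall (V : finType) (f k : V -> S),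
  Phi (graph f k) a = #|S|%:R^-1 * \sum_(h : {ffun V -> S}) Phi (graph f h) a * Phi (graph h k) a.
Proof.
split=> [e V f k|e]; first by rewrite -Phi_mul e.
by apply: Phi_inj => L _; rewrite -(graph_set L) Phi_mul -e.
Qed.

End FrobeniusMarks.

(** * Systems as equivalence relations on functions *)

Section SystemRelation.
Variable S : finGroupType.
Implicit Types (A : {set {group S * S}}) (V W : finType) (a : QB S S).

(** For [A = SysF F] this means that some morphism on the subgroup generated by the [g v] sends each
    [g v] to [f v]. *)
Definition related A V (f g : V -> S) : bool := <<graph f g>>%G \in A.

Section Sys.
Variables (A : {set {group S * S}}) (sysA : is_system A).

Lemma related_sub V (f g : V -> S) (L : {group S * S}) :
  L \in A -> graph f g \subset L -> related A f g.
Proof. by move=> LA fgL; apply: (sys_sub sysA LA); rewrite gen_subG. Qed.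

Lemma related_mono V W (f g : V -> S) (f' g' : W -> S) :
  graph f g \subset graph f' g' -> related A f' g' -> related A f g.
Proof. by move=> s /related_sub; apply; apply: subset_trans s (subset_gen _). Qed.

Lemma related_sym V (f g : V -> S) : related A f g = related A g f.
Proof.
suff imp (f' g' : V -> S) : related A f' g' -> related A g' f' by apply/idP/idP; apply: imp.
move=> /(sys_opp sysA)/related_sub; apply; apply: sub_graph => v.
by apply/imsetP; exists (f' v, g' v) => //; apply/mem_gen/mem_graph.
Qed.

Lemma related_trans V (g f h : V -> S) : related A f g -> related A g h -> related A f h.
Proof.
move=> fg gh; apply: (related_sub (sys_star sysA fg gh)); apply: sub_graph => v.
rewrite inE; apply/existsP; exists (g v) => /=.
by rewrite !mem_gen ?mem_graph.
Qed.

Lemma related_conj V (f : V -> S) s : related A (fun v => f v ^ s) f.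
Proof.
apply: (related_sub (sys_conj sysA (s, 1) (sys_diag sysA))); apply: sub_graph => v.
apply/imsetP; exists (f v, f v); first by apply/imsetP; exists (f v).
by rewrite -[RHS]/(f v ^ s, f v ^ 1) conjg1.
Qed.

End Sys.

Lemma related_FixSet a V (f g : V -> S) : related (FixSet a) f g = (Phi (graph f g) a != 0%R).
Proof.
rewrite /related inE /= Phi_gen; case: eqP => /= [|/eqP nz]; first by rewrite andbF.
by rewrite andbT; apply/asboolP; apply: (@Phi_twisted _ _ <<graph f g>>%G a); rewrite /= Phi_gen.
Qed.

Local Open Scope ring_scope.

Section Idem.
Variables (a : QB S S) (idem_a : is_idem a).
Let R : right_frobenius_marks a := proj1 (right_frobeniusE a) (proj1 (idem_frobenius idem_a)).
Let L : left_frobenius_marks a := proj1 (left_frobeniusE a) (proj2 (idem_frobenius idem_a)).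

Lemma idem_diag_neq0 V (f : V -> S) : Phi (graph f f) a != 0.
Proof.
rewrite -related_FixSet /related; apply: (idem_sub idem_a (idem_diag idem_a)).
rewrite gen_subG; apply: sub_graph => v.
by apply/imsetP; exists (f v).
Qed.

(** Right Frobenius gives [m g f * m f g = m g g * m f g]; cancelling [m f g] shows that [m g f]
    equals [m g g], a non-zero diagonal mark. Exchanging [f] and [g] gives the first equality, and
    the left identity the second. *)
Lemma idem_const V (f g : V -> S) : Phi (graph f g) a != 0 ->
  Phi (graph f g) a = Phi (graph f f) a /\ Phi (graph g f) a = Phi (graph f f) a.
Proof.
move=> nz; have gf : Phi (graph g f) a = Phi (graph g g) a.
  by apply: (mulIf nz); rewrite -R mulrC.
have nz' : Phi (graph g f) a != 0 by rewrite gf idem_diag_neq0.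
have fg : Phi (graph f g) a = Phi (graph f f) a.
  by apply: (mulIf nz'); rewrite -R mulrC.
split=> //; apply: (mulIf nz); rewrite mulrC -L; by rewrite mulrC.
Qed.

Lemma idem_marks V (f g : V -> S) : Phi (graph f g) a =
  if related (FixSet a) f g then #|S|%:R / #|[set h : {ffun V -> S} | related (FixSet a) h f]|%:R
  else 0.
Proof.
rewrite related_FixSet; case: ifPn => [nz|]; last by rewrite negbK => /eqP.
have [-> _] := idem_const nz.
set c := Phi (graph f f) a; have c0 : c != 0 by apply: idem_diag_neq0.
set n := #|_|%:R; have S0 : #|S|%:R != 0 :> rat by rewrite pnatr_eq0 -lt0n -cardsT cardG_gt0.
(* Only the [n] functions in the class of [f] contribute to the idempotent sum, each by [c * c];
   cancelling [c] gives [c = #|S| / n]. *)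
have : c = #|S|%:R^-1 * (n * (c * c)).
  rewrite {1}/c (proj1 (idem_mulE a) (idem_mul idem_a)); congr (_ * _).
  rewrite /n mulr_natl -sumr_const [RHS]big_mkcond /=; apply: eq_bigr => h _.
  rewrite inE related_FixSet; case: ifPn => [hf|]; last by rewrite negbK => /eqP ->; rewrite mulr0.
  have [e1 e2] := idem_const hf.
  have fh : Phi (graph f h) a != 0 by rewrite e2 -e1.
  by rewrite (proj2 (idem_const fh)) (proj1 (idem_const fh)).
move=> e; have n0 : n != 0 by apply: contraNneq c0 => n0; rewrite e n0 mul0r mulr0.
apply: (mulIf c0); rewrite [RHS]mulrAC -[LHS]/(c * c); apply: (mulIf n0); rewrite divfK //.
by rewrite {3}e mulVKf // mulrC.
Qed.

Lemma idem_system : is_system (FixSet a).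
Proof.
(* By the right Frobenius identity, [m f h * m g h] equals the non-zero product [m f g * m g h]. *)
have tr V (f g h : V -> S) : related (FixSet a) f g -> related (FixSet a) g h -> related (FixSet a) f h.
  rewrite !related_FixSet => fg gh; have : Phi (graph f h) a * Phi (graph g h) a != 0.
    by rewrite R mulf_neq0.
  by apply: contraNneq => ->; rewrite mul0r.
have sy V (f g : V -> S) : related (FixSet a) f g -> related (FixSet a) g f.
  by rewrite !related_FixSet => /idem_const[_ ->]; apply: idem_diag_neq0.
have mono V (f g : V -> S) (M : {group S * S}) : M \in FixSet a -> graph f g \subset M ->
    related (FixSet a) f g.
  by move=> MF s; apply: (idem_sub idem_a MF); rewrite gen_subG.
split; [| |exact: idem_sub| | |exact: idem_diag].
- by move=> M; rewrite inE => /andP[/asboolP].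
- move=> M z MF; have := MF; rewrite !inE /= Phi_conj => /andP[_ nz]; rewrite nz andbT.
  by apply/asboolP; apply: (@Phi_twisted _ _ (M :^ z)%G a); rewrite /= Phi_conj.
- move=> M N MF NF; rewrite -(gen_graph_set (star_group M N)).
  (* Triples with a common middle entry: closure under [star] becomes transitivity through the
     middle coordinate. *)
  pose V := {z : S * S * S | ((z.1.1, z.1.2) \in M) && ((z.1.2, z.2) \in N)}.
  have /mono : graph (fun v : {z | z \in star_group M N} => (val v).1) (fun v => (val v).2) \subset
     <<graph (fun v : V => (val v).1.1) (fun v => (val v).2)>>%G.
    rewrite graph_set; apply: subset_trans (subset_gen _); apply/subsetP => -[g k].
    rewrite inE => /existsP[h /= ghk]; apply/imsetP.
    by exists (exist _ (g, h, k) ghk).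
  apply; apply: (tr _ _ (fun v : V => (val v).1.2)).
    by apply: (mono _ _ _ _ MF); apply: sub_graph => v; case/andP: (valP v).
  by apply: (mono _ _ _ _ NF); apply: sub_graph => v; case/andP: (valP v).
- move=> M MF; rewrite -(gen_graph_set (opp_group M)).
  have /mono : graph (fun v : {z | z \in opp_group M} => (val v).1) (fun v => (val v).2) \subset
     <<graph (fun v : {z | z \in M} => (val v).2) (fun v => (val v).1)>>%G.
    rewrite graph_set; apply: subset_trans (subset_gen _); apply/subsetP => _ /imsetP[z zM ->].
    by apply/imsetP; exists (exist _ z zM).
  apply; apply: sy; apply: (mono _ _ _ _ MF); rewrite graph_set //.
Qed.
End Idem.

Lemma FixSet_inj a b : is_idem a -> is_idem b -> FixSet a = FixSet b -> a = b.
Proof.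
move=> ia ib e; apply: Phi_inj => L _.
by rewrite -(graph_set L) !idem_marks // e.
Qed.

(** Marks constant on the classes of an equivalence relation and zero across classes satisfy both
    Frobenius identities; the value of the constant yields idempotency. *)
Lemma marks_idem A a : is_system A ->
    (forall V (f g : V -> S), Phi (graph f g) a =
      if related A f g then #|S|%:R / #|[set h : {ffun V -> S} | related A h f]|%:R else 0) ->
  is_idem a /\ FixSet a = A.
Proof.
move=> sysA aE.
have S0 : #|S|%:R != 0 :> rat by rewrite pnatr_eq0 -lt0n -cardsT cardG_gt0.
pose n V (f : V -> S) : rat := #|[set h : {ffun V -> S} | related A h f]|%:R.
have n0 V (f : V -> S) : n V f != 0.
  rewrite pnatr_eq0 -lt0n; apply/card_gt0P; exists (finfun f); rewrite inE.
  apply: (related_sub sysA (sys_diag sysA)); apply: sub_graph => v.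
  by apply/imsetP; exists (f v); rewrite // ffunE.
have nE V (f g : V -> S) : related A f g -> n V f = n V g.
  move=> fg; congr (_%:R); apply: eq_card => h; rewrite !inE; apply/idP/idP => hf.
    exact: (related_trans sysA hf).
  by apply: (related_trans sysA hf); rewrite related_sym.
have FE : FixSet a = A.
  apply/setP => L; rewrite inE; rewrite -{2}(graph_set L) aE.
  rewrite /related gen_graph_set; case: ifP => [LA|]; last by rewrite eqxx andbF.
  by rewrite mulf_neq0 ?invr_eq0 ?n0 // andbT; apply/asboolP/(sys_twisted sysA).
split=> //; split.
- apply/idem_mulE => V f k; rewrite aE.
  case: ifP => fk; last first.
    rewrite big1 ?mulr0 // => h _; rewrite !aE; case: ifP => fh; last by rewrite mul0r.
    case: ifP => hk; last by rewrite mulr0.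
    by rewrite (related_trans sysA fh hk) in fk.
  rewrite -/(n V f); apply: (mulfI S0); rewrite mulVKf //.
  (* There are [n] equal terms, and [n * (#|S| / n) ^+ 2] is [#|S|] times the mark. *)
  transitivity (\sum_(h in [set h : {ffun V -> S} | related A h f]) (#|S|%:R / n V f) ^+ 2).
    by rewrite sumr_const -[RHS]mulr_natl -[X in _ = X * _]/(n V f) expr2 mulrA [n V f * _]mulrC divfK // mulrC.
  rewrite big_mkcond; apply: eq_bigr => h _; rewrite inE !aE (related_sym sysA f).
  case: ifP => hf; last by rewrite mul0r.
  rewrite (related_trans sysA hf fk) -!/(n V _) (nE _ _ _ hf) expr2 //.
- have R : right_frobenius_marks a.
    move=> V f g k; rewrite !aE; case: (boolP (related A g k)) => gk; last by rewrite !mulr0.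
    suff -> : related A f k = related A f g by [].
    apply/idP/idP => [fk|fg]; last exact: (related_trans sysA fg).
    by apply: (related_trans sysA fk); rewrite related_sym.
  split; [exact/right_frobeniusE|apply/left_frobeniusE => V f g k].
  (* These marks are symmetric, so the left identity follows from the right one. *)
  have sy (u v : V -> S) : Phi (graph u v) a = Phi (graph v u) a.
    by rewrite !aE related_sym //; case: ifP => // vu; rewrite -!/(n V _) (nE _ _ _ vu).
  by rewrite (sy k f) (sy k g) R (sy f g) mulrC.
- by rewrite FE; apply: (sys_sub sysA).
- by rewrite FE; apply: (sys_diag sysA).
Qed.
End SystemRelation.

(** * Systems and fusion systems *)

Section InjHoms.
Variable S : finGroupType.
Implicit Types (A : {set {group S * S}}) (P Q R : {group S}) (L M : {group S * S}).

Lemma restrE (P : {set S}) (f : S -> S) x : x \in P -> restr P f x = f x.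
Proof. by move=> xP; rewrite ffunE xP. Qed.

Lemma restr_out (P : {set S}) (f : S -> S) x : x \notin P -> restr P f x = 1.
Proof. by move=> /negPf xP; rewrite ffunE xP. Qed.

Lemma conj_mapE (P : {set S}) s x : x \in P -> conj_map P s x = x ^ s^-1.
Proof. exact: restrE. Qed.

Lemma InjHomP (P Q : {set S}) (f : {ffun S -> S}) :
  reflect [/\ forall x, x \notin P -> f x = 1, {in P &, {morph f : x y / x * y}},
              {in P &, injective f} & forall x, x \in P -> f x \in Q]
          (f \in InjHom P Q).
Proof.
rewrite inE; apply: (iffP and4P) => [[/eqP fE /morphicP fM /dinjectiveP fI /subsetP fQ]|[fE fM fI fQ]].
  split=> // [x xP|x xP]; first by rewrite fE restr_out.
  by apply/fQ/imset_f.
split; [|exact/morphicP|exact/dinjectiveP|].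
  apply/eqP/ffunP => x; case: (boolP (x \in P)) => xP; first by rewrite restrE.
  by rewrite fE // restr_out.
by apply/subsetP => _ /imsetP[x xP ->]; apply: fQ.
Qed.

Lemma InjHom1 P (Q : {set S}) f : f \in InjHom P Q -> f 1 = 1.
Proof.
by case/InjHomP=> _ fM _ _; apply: (mulgI (f 1)); rewrite -fM ?group1 // !mulg1.
Qed.

Lemma InjHom_image_group P (Q : {set S}) f : f \in InjHom P Q -> group_set (f @: P).
Proof.
move=> fPQ; have [_ fM _ _] := InjHomP _ _ _ fPQ.
apply/group_setP; split=> [|_ _ /imsetP[x xP ->] /imsetP[y yP ->]].
  by rewrite -(InjHom1 fPQ) imset_f.
by rewrite -fM // imset_f // groupM.
Qed.

(** Off [P] both functions are 1 and contribute only [(1, 1)], which already lies in [Delta f P]; so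
    all of [S] can serve as index type. *)
Lemma Delta_graph P (Q : {set S}) f : f \in InjHom P Q -> Delta f P = graph f (restr P id).
Proof.
move=> fPQ; have [fE _ _ _] := InjHomP _ _ _ fPQ.
apply/setP => z; apply/imsetP/imsetP => [[v vP ->]|[v _ ->]].
  by exists v; rewrite // restrE.
case: (boolP (v \in P)) => vP; first by exists v; rewrite // restrE.
by exists 1; rewrite // restr_out // fE // (InjHom1 fPQ).
Qed.

Lemma Delta_group_set P (Q : {set S}) f : f \in InjHom P Q -> group_set (Delta f P).
Proof.
move=> fPQ; have [_ fM _ _] := InjHomP _ _ _ fPQ.
apply/group_setP; split=> [|_ _ /imsetP[x xP ->] /imsetP[y yP ->]].
  by apply/imsetP; exists 1; rewrite // (InjHom1 fPQ).
by apply/imsetP; exists (x * y); rewrite ?groupM // fM.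
Qed.

Lemma gen_Delta P (Q : {set S}) f : f \in InjHom P Q -> <<Delta f P>> = Delta f P.
Proof. by move=> fPQ; apply: (genGid (Group (Delta_group_set fPQ))). Qed.

Lemma Delta_eq (P P' : {set S}) (f f' : S -> S) :
  Delta f P = Delta f' P' -> P = P' /\ {in P, f =1 f'}.
Proof.
have imp (Q Q' : {set S}) (k k' : S -> S) : Delta k Q = Delta k' Q' ->
    forall x, x \in Q -> x \in Q' /\ k x = k' x.
  move=> e x xQ; have : (k x, x) \in Delta k Q by apply/imsetP; exists x.
  by rewrite e => /imsetP[y yQ' [-> ->]].
move=> e; split=> [|x /(imp _ _ _ _ e)[]//].
by apply/setP => x; apply/idP/idP; [move/(imp _ _ _ _ e)|move/(imp _ _ _ _ (esym e))]; case.
Qed.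

Lemma twisted_Delta L : twisted L ->
  exists P : {group S}, exists2 f, f \in InjHom P [set: S] & L = Delta f P :> {set _}.
Proof.
case=> U [P [f [/isomP[/injmP fI _] ->]]]; exists P, (restr P f).
  apply/InjHomP; split=> [x|x y xP yP|x y xP yP|//]; first exact: restr_out.
    by rewrite !restrE ?groupM // morphM.
  by rewrite !restrE //; apply: fI.
by apply: eq_in_imset => x xP; rewrite restrE.
Qed.

Lemma mem_snd L v : reflect (exists2 z, z \in L & v = z.2) (v \in (@snd S S @* L)%G).
Proof. by rewrite /= morphimEsub ?subsetT //; apply: imsetP. Qed.

(** The inclusion of [P] is taken as [restr P id] so that the graph in question is [Delta f P], by
    [Delta_graph]. *)
Definition fus_of A : homsys S := fun P Q =>
  [set f in InjHom P Q | related A f (restr P id)].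

Lemma fus_ofE A P Q f : (f \in fus_of A P Q) = (f \in InjHom P Q) && related A f (restr P id).
Proof. by rewrite inE. Qed.

Lemma related_Delta A P (Q : {set S}) f : f \in InjHom P Q ->
  related A f (restr P id) = (<<Delta f P>>%G \in A).
Proof. by move=> fPQ; rewrite (Delta_graph fPQ). Qed.

Lemma inv_mapK P (Q : {set S}) f : f \in InjHom P Q ->
  forall x, x \in P -> inv_map P f (f x) = x.
Proof.
move=> /InjHomP[_ _ fI _] x xP; rewrite ffunE.
case: pickP => [y /andP[yP /eqP/fI] -> //|/(_ x)].
by rewrite xP eqxx.
Qed.

Lemma inv_map_out (P : {set S}) (f : S -> S) y : y \notin f @: P -> inv_map P f y = 1.
Proof.
move=> yP; rewrite ffunE; case: pickP => // x /andP[xP /eqP e].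
by case/imsetP: yP; exists x.
Qed.

(** * From systems to fusion systems *)

Section OfSystem.
Variables (A : {set {group S * S}}) (sysA : is_system A).

(** Composition comes from transitivity of [related], inverses from its symmetry, and conjugation
    maps from [related_conj]. *)
Lemma fus_of_fusion : is_fusion (fus_of A).
Proof.
split.
- move=> P Q R f g; rewrite !fus_ofE => /andP[fPQ fA] /andP[gQR gA].
  have [fE fM fI fQ] := InjHomP _ _ _ fPQ; have [gE gM gI gR] := InjHomP _ _ _ gQR.
  apply/andP; split.
    apply/InjHomP; split=> [x|x y xP yP|x y xP yP|x xP]; first exact: restr_out.
    + by rewrite !restrE ?groupM //= fM // gM // fQ.
    + by rewrite !restrE //= => /gI e; apply: fI => //; apply: e; apply: fQ.
    + by rewrite restrE //=; apply/gR/fQ.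
  (* The composite and [f] are the pair [g], [restr Q id] reindexed along [f]; indices outside [P]
     give [(1, 1)]. *)
  apply: (related_trans sysA _ fA); apply: (related_mono sysA _ gA); apply: sub_graph => v.
  apply/imsetP; case: (boolP (v \in P)) => vP.
    by exists (f v); rewrite // !restrE ?fQ.
  by exists 1; rewrite // (restr_out _ vP) (fE _ vP) (InjHom1 gQR) restrE // group1.
- move=> P Q; apply/subsetP => _ /imsetP[s sP ->]; rewrite fus_ofE.
  move: sP; rewrite inE => sPQ.
  apply/andP; split.
    apply/InjHomP; split=> [x|x y xP yP|x y xP yP|x xP]; first exact: restr_out.
    + by rewrite !restrE ?groupM // conjMg.
    + by rewrite !restrE // => /conjg_inj.
    + by rewrite restrE //; apply: (subsetP sPQ); rewrite memJ_conjg.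
  apply: (related_mono sysA _ (related_conj sysA id s^-1)); apply: sub_graph => v.
  apply/imsetP; case: (boolP (v \in P)) => vP; first by exists v; rewrite // !restrE.
  by exists 1; rewrite // !restr_out // conj1g.
- by move=> P Q; apply/subsetP => f; rewrite fus_ofE => /andP[].
- move=> P Q R f; rewrite !fus_ofE => /andP[fPQ fA] fR.
  have [fE fM fI fQ] := InjHomP _ _ _ fPQ; have fK := inv_mapK fPQ.
  have memR x : x \in P -> f x \in R by move=> xP; rewrite -fR imset_f.
  split; first by rewrite fA andbT; apply/InjHomP.
  apply/andP; split.
    apply/InjHomP; rewrite -fR; split=> [x|||]; first exact: inv_map_out.
    + by move=> _ _ /imsetP[x xP ->] /imsetP[y yP ->]; rewrite -fM // !fK ?groupM.
    + by move=> _ _ /imsetP[x xP ->] /imsetP[y yP ->]; rewrite !fK // => ->.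
    + by move=> _ /imsetP[x xP ->]; rewrite fK.
  rewrite related_sym // in fA; apply: (related_mono sysA _ fA); apply: sub_graph => v.
  apply/imsetP; case: (boolP (v \in R)) => [|vR].
    by rewrite -fR => /imsetP[x xP ->]; exists x; rewrite // fK // !restrE // imset_f.
  exists 1; rewrite // inv_map_out ?fR // restr_out // (InjHom1 fPQ) restrE //.
Qed.

Lemma SysFP (F : homsys S) L : reflect (exists P : {group S}, exists2 f : {ffun S -> S},
  f \in F P (full S) & L = Delta f P :> {set _}) (L \in SysF F).
Proof.
rewrite inE; apply: (iffP existsP) => [[P /exists_inP[f fF /eqP e]]|[P [f fF e]]].
  by exists P, f.
by exists P; apply/exists_inP; exists f => //; apply/eqP.
Qed.

Lemma SysF_fus_of : SysF (fus_of A) = A.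
Proof.
apply/setP => L; apply/SysFP/idP => [[P [f]]|LA].
  rewrite fus_ofE => /andP[fP]; rewrite (related_Delta _ fP) => DA e.
  by rewrite (_ : L = <<Delta f P>>%G) //; apply: val_inj; rewrite /= (gen_Delta fP).
have [P [f fP e]] := twisted_Delta (sys_twisted sysA LA); exists P, f => //.
rewrite fus_ofE fP (related_Delta _ fP) (_ : <<Delta f P>>%G = L) //.
by apply: val_inj; rewrite /= (gen_Delta fP).
Qed.

(** Precomposition with [f] is the bijection: a morphism is determined by its values on the
    generators [f v], and for [h] related to [f] the group [<<graph h f>>] is the graph of a
    morphism taking [f v] to [h v]. *)
Lemma card_class (V : finType) (f : V -> S) :
  #|[set h : {ffun V -> S} | related A h f]| = #|fus_of A <<[set f v | v : V]>>%G (full S)|.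
Proof.
set P := <<_>>%G; have fP v : f v \in P by apply/mem_gen/imsetP; exists v.
pose r (k : {ffun S -> S}) : {ffun V -> S} := [ffun v => k (f v)].
rewrite (_ : [set h | _] = r @: fus_of A P (full S)).
  apply: card_in_imset => k k'; rewrite !fus_ofE => /andP[/InjHomP[kE kM _ _] _].
  move=> /andP[/InjHomP[kE' kM' _ _] _] e.
  (* The subgroup on which [k] and [k'] agree; it contains the generators of [P]. *)
  have gD : group_set [set x in P | k x == k' x].
    apply/group_setP; split=> [|x y]; rewrite !inE.
      rewrite group1 -(inj_eq (mulgI (k 1))) -kM ?group1 // mulg1.
      rewrite -(inj_eq (mulIg (k' 1))) -[X in _ == X]mulgA -kM' ?group1 // mulg1 eqxx //.
    by case/andP=> xP /eqP ex /andP[yP /eqP ey]; rewrite groupM //= kM // kM' // ex ey.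
  have /subsetP PD : P \subset Group gD.
    rewrite gen_subG; apply/subsetP => _ /imsetP[v _ ->]; rewrite inE fP.
    by have /ffunP/(_ v) := e; rewrite !ffunE => ->; rewrite eqxx.
  apply/ffunP => x; case: (boolP (x \in P)) => xP; last by rewrite kE // kE'.
  by have := PD _ xP; rewrite inE => /andP[_ /eqP].
apply/setP => h; rewrite inE; apply/idP/imsetP => [hf|[k]]; last first.
  rewrite fus_ofE => /andP[_ kA] ->; apply: (related_mono sysA _ kA); apply: sub_graph => v.
  by apply/imsetP; exists (f v); rewrite // restrE // ffunE.
have [W [k kW e]] := twisted_Delta (sys_twisted sysA hf).
have hfD v : (h v, f v) \in Delta k W by rewrite -e mem_gen // mem_graph.
have eW : W = P.
  apply/val_inj/eqP; rewrite eqEsubset; apply/andP; split; last first.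
    by rewrite gen_subG; apply/subsetP => _ /imsetP[v _ ->]; have /imsetP[w wW [_ ->]] := hfD v.
  apply/subsetP => w wW; have : (k w, w) \in <<graph h f>>%G by rewrite e; apply/imsetP; exists w.
  have /subsetP s : <<graph h f>>%G \subset setX [set: S] P.
    by rewrite gen_subG; apply: sub_graph => v; rewrite in_setX in_setT fP.
  by move/s; rewrite in_setX => /andP[].
subst W; exists k.
  rewrite fus_ofE kW (related_Delta _ kW); move: hf; rewrite /related; congr (_ \in A).
  by apply: val_inj; rewrite /= e (gen_Delta kW).
by apply/ffunP => v; rewrite ffunE; have /imsetP[w wW [-> ->]] := hfD v.
Qed.
End OfSystem.

(** * From fusion systems to systems *)

Section OfFusion.
Variables (F : homsys S) (fusF : is_fusion F).

Lemma fus_InjHom P Q f : f \in F P Q -> f \in InjHom P Q.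
Proof. exact: (subsetP (fus_inj fusF P Q)). Qed.

Lemma fus_conj P Q s : P :^ s^-1 \subset Q -> conj_map P s \in F P Q.
Proof.
by move=> sPQ; apply: (subsetP (fus_inner fusF P Q)); apply/imsetP; exists s; rewrite // inE.
Qed.

Lemma fus_incl P Q : P \subset Q -> conj_map P 1 \in F P Q.
Proof. by move=> sPQ; apply: fus_conj; rewrite invg1 conjsg1. Qed.

(** The codomain is changed through the image: [fus_iso] shrinks to it, and composing with an
    inclusion enlarges to [R]. *)
Lemma fus_codom P Q R f : f \in F P Q -> (forall x, x \in P -> f x \in R) -> f \in F P R.
Proof.
move=> fF fR; have fPQ := fus_InjHom fF; have [fE _ _ _] := InjHomP _ _ _ fPQ.
have [fF' _] := fus_iso fusF (R := Group (InjHom_image_group fPQ)) fF (erefl _).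
have sR : Group (InjHom_image_group fPQ) \subset R.
  by apply/subsetP => _ /imsetP[x xP ->]; exact: (fR x xP).
have := fus_comp fusF fF' (fus_incl sR); congr (_ \in F P R); apply/ffunP => x.
case: (boolP (x \in P)) => xP; last by rewrite restr_out ?fE.
by rewrite restrE //= restrE ?imset_f // invg1 conjg1.
Qed.

Lemma fus_restr P Q R f : f \in F P Q -> R \subset P -> restr R f \in F R Q.
Proof.
move=> fF sRP; have := fus_comp fusF (fus_incl sRP) fF; congr (_ \in F R Q); apply/ffunP => x.
case: (boolP (x \in R)) => xR; last by rewrite !restr_out.
by rewrite !restrE //= restrE // invg1 conjg1.
Qed.

Lemma SysF_system : is_system (SysF F).
Proof.
split.
- move=> L /SysFP[P [f /fus_InjHom fP ->]].
  have [_ _ fI _] := InjHomP _ _ _ fP.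
  apply: (@twistedP _ _ (Group (Delta_group_set fP))) => _ /imsetP[v vP ->] /=.
    by rewrite -(InjHom1 fP) => /fI -> //; rewrite (InjHom1 fP).
  by move=> ->; rewrite (InjHom1 fP).
- move=> L [s t] /SysFP[P [f fF e]]; apply/SysFP; exists (P :^ t)%G.
  have ct : conj_map (P :^ t) t \in F (P :^ t)%G P.
    by apply: fus_conj; rewrite -conjsgM mulgV conjsg1.
  have cs : conj_map (full S) s^-1 \in F (full S) (full S).
    by apply: fus_conj; rewrite subsetT.
  (* Conjugating [Delta f P] by [(s, t)] conjugates [f] by [s] at the target and by [t] at the
     source. *)
  pose k := restr (P :^ t) (conj_map (full S) s^-1 \o restr (P :^ t) (f \o conj_map (P :^ t) t)).
  have kE w : w \in P :^ t -> k w = f (w ^ t^-1) ^ s.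
    move=> wP; rewrite restrE // [LHS]/= conj_mapE ?inE // restrE // [X in X ^ _ = _]/=.
    by rewrite conj_mapE // invgK.
  exists k; first exact: (fus_comp fusF (fus_comp fusF ct fF) cs).
  rewrite /= e; apply/setP => z; apply/imsetP/imsetP => [[_ /imsetP[v vP ->] ->]|[w wP ->]].
    by exists (v ^ t); rewrite ?kE ?memJ_conjg // conjgK.
  exists (f (w ^ t^-1), w ^ t^-1); first by apply/imsetP; exists (w ^ t^-1); rewrite // -mem_conjg.
  by rewrite kE // -[RHS]/(_ ^ s, (w ^ t^-1) ^ t) conjgKV.
- move=> L M /SysFP[P [f fF e]] sML; apply/SysFP.
  have MP z : z \in M -> z.2 \in P /\ z.1 = f z.2.
    by move/(subsetP sML); rewrite e => /imsetP[v vP ->].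
  exists (@snd S S @* M)%G, (restr (@snd S S @* M)%G f).
    by apply: (fus_restr fF); apply/subsetP => v /mem_snd[z /MP[zP _] ->].
  apply/setP => z; apply/idP/imsetP => [zM|[v vM ->]].
    have zM2 : z.2 \in (@snd S S @* M)%G by apply/mem_snd; exists z.
    by exists z.2; rewrite // restrE // -(proj2 (MP _ zM)) -surjective_pairing.
  have /mem_snd[w wM ew] := vM; rewrite restrE // ew -(proj2 (MP _ wM)).
  by rewrite -surjective_pairing.
- move=> L M /SysFP[P [f fF e]] /SysFP[Q [g gF e']]; apply/SysFP.
  (* [R] is the preimage of [P] under [g]; as a projection of [star_group L M] it is a group by
     construction. *)
  set R := (@snd S S @* star_group L M)%G; exists R.
  have starE z : (z \in star_group L M) = [&& z.2 \in Q, g z.2 \in P & z.1 == f (g z.2)].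
    rewrite inE; apply/existsP/and3P => [[h /andP[]]|[zQ zP /eqP ez]].
      by rewrite e e' => /imsetP[v vP [-> ->]] /imsetP[w wQ [ew ->]]; subst v; split.
    exists (g z.2); rewrite e e'; apply/andP; split; apply/imsetP; last by exists z.2.
    by exists (g z.2); rewrite // ez.
  have RP k : k \in R -> k \in Q /\ g k \in P.
    by case/mem_snd=> z; rewrite starE => /and3P[zQ zP _] ->.
  have gR : restr R g \in F R P.
    apply: (fus_codom (Q := full S)) => [|k kR]; last by rewrite restrE //; case: (RP k kR).
    by apply: (fus_restr gF); apply/subsetP => k /RP[].
  exists (restr R (f \o restr R g)); first exact: (fus_comp fusF gR fF).
  apply/setP => z; apply/idP/imsetP => [zM|[k kR ->]].
    have zR : z.2 \in R by apply/mem_snd; exists z.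
    exists z.2; rewrite // restrE //= restrE //; move: zM.
    by rewrite [z \in _]starE => /and3P[_ _ /eqP <-]; rewrite -surjective_pairing.
  have [kQ kP] := RP k kR.
  by rewrite [_ \in _]starE /= kQ kP restrE //= restrE.
- move=> L /SysFP[P [f fF e]]; apply/SysFP; have fP := fus_InjHom fF.
  have [_ iF] := fus_iso fusF (R := Group (InjHom_image_group fP)) fF (erefl _).
  exists (Group (InjHom_image_group fP)), (inv_map P f).
    by apply: (fus_codom iF) => x _; rewrite inE.
  apply/setP => z; rewrite /= /opp_set e; apply/imsetP/imsetP => [[_ /imsetP[v vP ->] ->]|[_ /imsetP[v vP ->] ->]].
    by exists (f v); rewrite ?imset_f //= (inv_mapK fP).
  by exists (f v, v); rewrite ?(inv_mapK fP) //; apply/imsetP; exists v.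
- apply/SysFP; exists (full S), (conj_map (full S) 1); first exact: fus_incl.
  apply/setP => z; apply/imsetP/imsetP => -[v _ ->]; exists v;
    by rewrite ?conj_mapE ?inE // invg1 conjg1.
Qed.

(** [Delta f P] determines [P] and [f], since [f] is 1 off [P]; [fus_codom] then handles the passage
    between [Q] and [full S]. *)
Lemma fus_of_SysF : fus_of (SysF F) = F.
Proof.
apply/funext => P; apply/funext => Q; apply/setP => f; rewrite fus_ofE.
apply/andP/idP => [[fPQ]|fF].
  have [fE _ _ fQ] := InjHomP _ _ _ fPQ.
  rewrite (related_Delta _ fPQ) => /SysFP[P' [f' fF']] /=.
  rewrite (gen_Delta fPQ) => /Delta_eq[/val_inj eP ef]; subst P'.
  apply: (fus_codom (Q := full S)) => //; suff -> : f = f' by [].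
  have [fE' _ _ _] := InjHomP _ _ _ (fus_InjHom fF').
  by apply/ffunP => x; case: (boolP (x \in P)) => xP; [apply: ef|rewrite fE ?fE'].
have fP := fus_InjHom fF; split=> //; rewrite (related_Delta _ fP); apply/SysFP.
exists P, f; last exact: gen_Delta fP.
by apply: (fus_codom fF) => x _; rewrite inE.
Qed.

End OfFusion.
End InjHoms.

(** * The element [omega] *)

Section Omega.
Variable S : finGroupType.
Implicit Types (A : {set {group S * S}}) (P Q R : {group S}) (L M : {group S * S}) (a b : QB S S).
Local Open Scope ring_scope.

(** A non-zero mark would place [L] inside a conjugate of a member of [A], hence in [A]. *)
Lemma Phi_span A (c : {group S * S} -> rat) L : is_system A -> L \notin A ->
  Phi L (\sum_(M in A) c M *: coset_class M) = 0.
Proof.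
move=> sysA LA; rewrite (raddf_sum (Phi L)) /= big1 // => M MA; rewrite linearZ /=.
have [->|/Phi_coset[w Lw]] := eqVneq (Phi L (coset_class M)) 0; first exact: mulr0.
by rewrite (sys_sub sysA (sys_conj sysA w MA) Lw) in LA.
Qed.

Lemma gen_snd_graph (V : finType) (f g : V -> S) :
  <<[set z.2 | z in <<graph f g>>]>>%g = <<[set g v | v : V]>>%g.
Proof.
apply/eqP; rewrite eqEsubset !gen_subG; apply/andP; split.
  have /subsetP s : <<graph f g>>%g \subset setX [set: S] <<[set g v | v : V]>>%G.
    rewrite gen_subG; apply: sub_graph => v; rewrite in_setX in_setT /=.
    by apply/mem_gen/imsetP; exists v.
  by apply/subsetP => _ /imsetP[[x y] /s + ->]; rewrite in_setX => /andP[].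
apply/subsetP => _ /imsetP[v _ ->]; apply/mem_gen/imsetP; exists (f v, g v) => //.
exact/mem_gen/mem_graph.
Qed.

Lemma card_class_related A (V : finType) (f g : V -> S) : is_system A -> related A f g ->
  #|[set h : {ffun V -> S} | related A h f]| = #|[set h : {ffun V -> S} | related A h g]|.
Proof.
move=> sysA fg; apply: eq_card => h; rewrite !inE; apply/idP/idP => hf.
  exact: (related_trans sysA hf).
by apply: (related_trans sysA hf); rewrite related_sym.
Qed.

(** [mark_exists] prescribes values at subgroups, so the class size is first rewritten, by
    [card_class], as a number of morphisms out of the second projection. *)
Lemma system_element A : is_system A -> exists c : {group S * S} -> rat,
  forall (V : finType) (f g : V -> S), Phi (graph f g) (\sum_(M in A) c M *: coset_class M) =
  if related A f g then #|S|%:R / #|[set h : {ffun V -> S} | related A h f]|%:R else 0.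
Proof.
move=> sysA; pose t L : rat := #|S|%:R / #|fus_of A <<[set z.2 | z in L]>>%G (full S)|%:R.
have [|||c cP] := @mark_exists _ _ A t.
- exact: (sys_twisted sysA).
- by move=> L w; apply: (sys_conj sysA).
(* Conjugation replaces the second coordinate function by a related one, which leaves the class size
   unchanged. *)
- move=> L [s u] LA; congr (_ / _%:R).
  pose V := {z | z \in L}; pose f (v : V) := (val v).2.
  rewrite (_ : <<[set z.2 | z in L]>>%G = <<[set f v | v : V]>>%G); last first.
    congr <<_>>%G; apply/setP => x; apply/imsetP/imsetP => [[z zL ->]|[v _ ->]].
      by exists (exist _ z zL).
    by exists (val v) => //; apply: (valP v).
  rewrite (_ : <<[set z.2 | z in (L :^ (s, u))%G]>>%G = <<[set (f v ^ u)%g | v : V]>>%G); last first.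
    congr <<_>>%G; apply/setP => x; apply/imsetP/imsetP => [[_ /imsetP[z zL ->] ->]|[v _ ->]].
      by exists (exist _ z zL).
    by exists ((val v) ^ (s, u))%g => //; rewrite memJ_conjg; apply: (valP v).
  by rewrite -!card_class //; apply/card_class_related/related_conj.
exists c => V f g; rewrite -Phi_gen.
case: ifP => [fg|/negbT nfg]; last by have := Phi_span c sysA nfg.
have /= -> := cP _ fg; rewrite /t (card_class_related sysA fg) card_class //.
by congr (_ / #|fus_of A _ _|%:R); apply: val_inj; apply: gen_snd_graph.
Qed.

(** * The equation defining [omega] and its solution *)

Section OfFusion.
Variables (F : homsys S) (fusF : is_fusion F).
Let sysF : is_system (SysF F) := SysF_system fusF.

Lemma fus_related P Q f : f \in F P Q -> related (SysF F) f (restr P id).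
Proof. by rewrite -{1}(fus_of_SysF fusF) fus_ofE => /andP[]. Qed.

Lemma card_fus P Q f : f \in F P Q ->
  #|[set h : {ffun S -> S} | related (SysF F) h f]| = #|F P (full S)|.
Proof.
move=> /fus_related fP; rewrite (card_class_related sysF fP) card_class // fus_of_SysF //.
congr #|pred_of_set (F _ _)|; apply/val_inj/eqP; rewrite /= eqEsubset gen_subG.
apply/andP; split; apply/subsetP => x.
  by case/imsetP=> v _ ->; rewrite ffunE; case: ifP => //; rewrite group1.
by move=> xP; apply/mem_gen/imsetP; exists x; rewrite // restrE.
Qed.

(** Turns the subgroup in the coefficients of [sigma] into the graph of a pair of morphisms out of
    [P]. *)
Lemma Delta_comp_inv P Q f g : f \in InjHom P Q -> g \in InjHom P Q ->
  Delta (f \o inv_map P g) (g @: P) = graph f g.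
Proof.
move=> fP gP; have [fE _ _ _] := InjHomP _ _ _ fP; have [gE _ _ _] := InjHomP _ _ _ gP.
apply/setP => z; apply/imsetP/imsetP => [[_ /imsetP[x xP ->] ->]|[v _ ->]].
  by exists x; rewrite //= (inv_mapK gP).
case: (boolP (v \in P)) => vP; first by exists (g v); rewrite ?imset_f //= (inv_mapK gP).
have g1 := InjHom1 gP.
exists 1%g; first by rewrite -g1 imset_f.
have i1 : inv_map P g 1%g = 1%g by rewrite -{1}g1 (inv_mapK gP).
by rewrite (fE _ vP) (gE _ vP) /= i1 (InjHom1 fP).
Qed.

Lemma fus_conjl P f s : f \in F P (full S) ->
  restr P (fun x => f x ^ s^-1)%g \in F P (full S).
Proof.
move=> fF; have cs : conj_map (full S) s \in F (full S) (full S).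
  by apply: (fus_conj fusF); rewrite subsetT.
have := fus_comp fusF fF cs; congr (_ \in F P _); apply/ffunP => x; rewrite !ffunE /=.
by case: ifP => // _; rewrite conj_mapE ?inE.
Qed.

Lemma hb_repP P (c : HomBar F P) f :
  val c = inn_class P f -> f \in F P (full S) ->
  exists s, hb_rep c = restr P (fun x => f x ^ s^-1)%g.
Proof.
move=> cf fF; rewrite /hb_rep cf; case: pickP => [k /imsetP[s _ ->]|/(_ f)] /=.
  by exists s.
have [fE _ _ _] := InjHomP _ _ _ (fus_InjHom fusF fF).
case/imsetP; exists 1%g => //; apply/ffunP => x; rewrite ffunE invg1 conjg1.
by case: ifPn => // /fE.
Qed.

Lemma hb_rep_fus P (c : HomBar F P) : hb_rep c \in F P (full S).
Proof.
have /imsetP[f fF cf] := valP c; have [s ->] := hb_repP cf fF.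
exact: fus_conjl.
Qed.

Lemma hb_endo_basis P (m : {ffun S -> S} -> {ffun S -> S} -> rat) (c d : HomBar F P) :
  hb_endo m (hb_basis c) d = m (hb_rep d) (hb_rep c).
Proof.
have bE (e f : HomBar F P) : hb_basis e f = (f == e)%:R by rewrite ffunE.
rewrite /hb_endo sum_ffunE (bigD1 c) //= [X in _ + X]big1 => [|e /negPf ec].
  rewrite addr0 ffunE bE eqxx scale1r sum_ffunE (bigD1 d) //= [X in _ + X]big1 => [|e /negPf ed].
    by rewrite addr0 ffunE bE eqxx; apply: mulr1.
  by rewrite ffunE bE eq_sym ed; apply: mulr0.
by rewrite ffunE bE ec scale0r.
Qed.

(** Two morphisms out of [P] are related through [restr P id], in a class of size [#|F P (full S)|];
    this turns the coefficients of [sigma] into those of [eps]. *)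
Lemma sigma_system_element a :
    (forall f g : S -> S, Phi (graph f g) a = if related (SysF F) f g then
       #|S|%:R / #|[set h : {ffun S -> S} | related (SysF F) h f]|%:R else 0) ->
  forall P, sigma a =1 @eps S F P.
Proof.
move=> aE P u; rewrite /sigma /eps /hb_endo; apply: eq_bigr => c _; congr (_ *: _).
apply: eq_bigr => d _; congr (_ *: _).
have cF := hb_rep_fus c; have dF := hb_rep_fus d.
rewrite (Delta_comp_inv (fus_InjHom fusF dF) (fus_InjHom fusF cF)) aE.
rewrite (related_trans sysF (fus_related dF)) ?(card_fus dF); first by rewrite -mulrA -invfM mulrC [X in _ * X^-1]mulrC mulrC.
by rewrite related_sym // (fus_related cF).
Qed.

Lemma F_isom_equiv : {in [set: {group S}] & &, equivalence_rel (F_isom F)}.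
Proof.
have sy P Q : F_isom F P Q = F_isom F Q P.
  suff imp P' Q' : F_isom F P' Q' -> F_isom F Q' P' by apply/idP/idP; apply: imp.
  case/exists_inP=> f fF /exists_inP[g gF /andP[e1 e2]].
  by apply/exists_inP; exists g => //; apply/exists_inP; exists f; rewrite ?e1 ?e2.
have tr P Q R : F_isom F P Q -> F_isom F Q R -> F_isom F P R.
  case/exists_inP=> f fF /exists_inP[g gF /andP[/eqP/ffunP e1 /eqP/ffunP e2]].
  case/exists_inP=> f' fF' /exists_inP[g' gF' /andP[/eqP/ffunP e1' /eqP/ffunP e2']].
  apply/exists_inP; exists (restr P (f' \o f)); first exact: (fus_comp fusF fF).
  apply/exists_inP; exists (restr R (g \o g')); first exact: (fus_comp fusF gF').
  have [_ _ _ fQ] := InjHomP _ _ _ (fus_InjHom fusF fF).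
  have [_ _ _ gQ] := InjHomP _ _ _ (fus_InjHom fusF gF').
  have [_ _ _ fQ'] := InjHomP _ _ _ (fus_InjHom fusF fF').
  have [_ _ _ gQ'] := InjHomP _ _ _ (fus_InjHom fusF gF).
  have K1 x : x \in P -> g (f x) = x by move=> xP; have := e1 x; rewrite !restrE.
  have K2 x : x \in Q -> f (g x) = x by move=> xP; have := e2 x; rewrite !restrE.
  have K1' x : x \in Q -> g' (f' x) = x by move=> xP; have := e1' x; rewrite !restrE.
  have K2' x : x \in R -> f' (g' x) = x by move=> xP; have := e2' x; rewrite !restrE.
  apply/andP; split; apply/eqP/ffunP => x; rewrite [LHS]ffunE [RHS]ffunE; case: ifP => // xP /=.
    by rewrite (restrE _ xP) restrE /= ?K1' ?K1 ?fQ' ?fQ.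
  by rewrite (restrE _ xP) restrE /= ?K2 ?K2' ?gQ' ?gQ.
move=> Q R P _ _ _; split=> [|PQ]; last first.
  by apply/idP/idP; apply: tr => //; rewrite sy.
have iF := fus_incl fusF (subxx P).
have iE x : x \in P -> conj_map P 1 x = x by move=> xP; rewrite conj_mapE // invg1 conjg1.
have e : restr P (conj_map P 1 \o conj_map P 1) = restr P id.
  apply/ffunP => x; case: (boolP (x \in P)) => xP; last by rewrite !restr_out.
  by rewrite !restrE //= !iE.
by apply/exists_inP; exists (conj_map P 1) => //; apply/exists_inP; exists (conj_map P 1); rewrite ?e ?eqxx.
Qed.

Lemma Ftilde_isom Q : exists2 P, P \in Ftilde F & F_isom F P Q.
Proof.
have part := equivalence_partitionP F_isom_equiv.
have /and3P[_ _ /forall_inP tr] := transversalP part.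
have QD : Q \in [set: {group S}] by rewrite inE.
have BP : pblock (equivalence_partition (F_isom F) [set: {group S}]) Q
    \in equivalence_partition (F_isom F) [set: {group S}].
  by apply: pblock_mem; rewrite (cover_partition part).
have /cards1P[P eP] := tr _ BP.
have : P \in [set P] by rewrite inE.
rewrite -eP inE => /andP[PF]; rewrite (pblock_equivalence_partition F_isom_equiv) ?inE // => QP.
exists P => //; have [e1 e2] := F_isom_equiv (in_setT Q) (in_setT P) (in_setT Q).
by rewrite -(e2 QP).
Qed.

(** Off [SysF F] both elements have zero marks. A mark at a member [Delta f Q] is, up to a
    centralizer order, a matrix coefficient of [sigma] at the [P] of the transversal isomorphic to
    [Q]. *)
Lemma sigma_inj a b : in_BF F a -> in_BF F b ->
    (forall P, P \in Ftilde F -> sigma (F := F) (P := P) a =1 sigma (F := F) (P := P) b) ->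
  a = b.
Proof.
move=> [ca ea] [cb eb] ab; apply: Phi_inj => L _.
have [LF|LF] := boolP (L \in SysF F); last first.
  by rewrite ea eb; transitivity (0 : rat); [|apply/esym]; exact: (Phi_span _ sysF LF).
have [Q [f fF eL]] := SysFP _ _ LF.
have [P PF /exists_inP[u uF /exists_inP[w wF /andP[_ /eqP/ffunP uw]]]] := Ftilde_isom Q.
have [uE _ _ uQ] := InjHomP _ _ _ (fus_InjHom fusF uF).
have [_ _ _ wP] := InjHomP _ _ _ (fus_InjHom fusF wF).
have uS : u \in F P (full S) by apply: (fus_codom fusF uF) => x _; rewrite inE.
have fuS : restr P (f \o u) \in F P (full S) := fus_comp fusF uF fF.
(* Reparametrize [L] by [P] through the isomorphism [u] onto [Q]. *)
have eLg : L = graph (restr P (f \o u)) u :> {set _}.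
  rewrite eL; apply/setP => z; apply/imsetP/imsetP => [[v vQ ->]|[x _ ->]].
    have uwv : u (w v) = v by have := uw v; rewrite !restrE.
    by exists (w v); rewrite // restrE ?wP //= uwv.
  case: (boolP (x \in P)) => xP; first by exists (u x); rewrite ?uQ // restrE.
  by exists 1%g; rewrite // restr_out // uE // (InjHom1 (fus_InjHom fusF fF)).
have mkHB k : k \in F P (full S) -> exists c : HomBar F P, val c = inn_class P k.
  by move=> kF; have kP := imset_f (inn_class P) kF; exists (exist _ (inn_class P k) kP).
have [c cE] := mkHB _ uS; have [d dE] := mkHB _ fuS.
have cF := hb_rep_fus c; have dF := hb_rep_fus d.
have [s sE] := hb_repP cE uS; have [t tE] := hb_repP dE fuS.
(* The chosen representatives differ from [restr P (f \o u)] and [u] by conjugations in [S],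
   invisible to marks. *)
have rep x : Phi L x = Phi (graph (hb_rep d) (hb_rep c)) x.
  rewrite eLg -(Phi_graphJ _ _ t^-1 s^-1)%g; congr Phi; apply: eq_imset => v.
  rewrite tE sE; case: (boolP (v \in P)) => vP; first by congr pair; rewrite [RHS]restrE.
  by congr pair; rewrite [RHS]restr_out // ?uE // ?restr_out // conj1g.
have := congr1 (fun k : QHomBar F P => k d) (ab P PF (hb_basis c)).
rewrite /sigma !hb_endo_basis (Delta_comp_inv (fus_InjHom fusF dF) (fus_InjHom fusF cF)).
rewrite -!rep; apply: mulIf; rewrite invr_eq0 pnatr_eq0 -lt0n.
exact: cardG_gt0.
Qed.

(** The element of [system_element] solves the equation defining [omega], and [sigma_inj] makes the
    solution unique. *)
Lemma omega_marks (V : finType) (f g : V -> S) : Phi (graph f g) (omega F) =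
  if related (SysF F) f g then #|S|%:R / #|[set h : {ffun V -> S} | related (SysF F) h f]|%:R
  else 0.
Proof.
have [c cE] := system_element sysF; set a := \sum_(M in _) _ in cE.
suff -> : omega F = a by exact: cE.
have aBF : in_BF F a by exists c.
have sa P : sigma a =1 @eps S F P by apply: sigma_system_element => *; apply: cE.
clearbody a; apply: xget_unique => [|b [bF sb]]; first by split=> // P _; apply: sa.
by apply: sigma_inj => // P PF u; rewrite sb // sa.
Qed.

Lemma omega_idem : is_idem (omega F) /\ FixSet (omega F) = SysF F.
Proof. exact: marks_idem sysF omega_marks. Qed.

End OfFusion.
End Omega.

(** * The three bijections *)

Theorem theorem7p15 (p : nat) (S : finGroupType) (p_pr : prime p)
    (pS : (p.-group [set: S])%g) :
  [/\ set_bij (Fus S) (Idem S) (@omega S),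
      set_bij (Idem S) (Sys S) (@FixSet S),
      set_bij (Fus S) (Sys S) (@SysF S)
    & forall F : homsys S, Fus S F -> FixSet (omega F) = SysF F].
Proof.
have gf (F : homsys S) : Fus S F -> FixSet (omega F) = SysF F by case/omega_idem.
have hI (F F' : homsys S) : Fus S F -> Fus S F' -> SysF F = SysF F' -> F = F'.
  by move=> fF fF' e; rewrite -(fus_of_SysF fF) e fus_of_SysF.
have fI (F : homsys S) : Fus S F -> Idem S (omega F) by case/omega_idem.
have hs A : Sys S A -> exists2 F : homsys S, Fus S F & SysF F = A.
  by move=> sA; exists (fus_of A); [exact: fus_of_fusion|exact: SysF_fus_of].
split; [split|split|split|exact: gf].
- exact: fI.
- move=> F F' /set_mem fF /set_mem fF' e; apply: (hI _ _ fF fF').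
  exact: etrans (esym (gf _ fF)) (etrans (congr1 (@FixSet S) e) (gf _ fF')).
(* For surjectivity, [F] is chosen with [SysF F = FixSet a]; then [omega F] and [a] are idempotents
   with the same [FixSet]. *)
- move=> a ia; have [F fF e] := hs _ (idem_system ia); exists F => //.
  exact: (FixSet_inj (fI _ fF) ia (etrans (gf _ fF) e)).
- by move=> a /idem_system.
- by move=> a b /set_mem ia /set_mem ib; exact: FixSet_inj ia ib.
- by move=> A /hs[F fF <-]; exists (omega F); [exact: fI|exact: gf].
- by move=> F /SysF_system.
- by move=> F F' /set_mem fF /set_mem fF'; exact: hI fF fF'.
- by move=> A /hs[F fF <-]; exists F.
Qed.
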